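(* Let $L(17)$ be the ternary code of length $36$ generated by $(I_{18},U_{17})$, and let \[H=\begin{pmatrix} I_{18}-U_{17}^T & U_{17}+I_{18}\\ I_{18}+U_{17}^T & U_{17}-I_{18}\end{pmatrix}.\] (i) Up to equivalence, there are exactly two Hadamard matrices of order $36$ all of whose rows are codewords of $L(17)$ of weight $36$ (reading the entry $2\in GF(3)$ as $-1$): one class is represented by $H$, which is equivalent to a Paley-Hadamard matrix of type II and has full automorphism group of order $19584$; the other is represented by a regular Hadamard matrix $H'$ such that the symmetric $2$-$(36,15,6)$ design $D'$ with $(0,1)$-incidence matrix $(H'+J)/2$ ($J$ the $36\times 36$ all-one matrix) has trivial full automorphism group. (ii) The row span over $GF(3)$ of the incidence matrix of $D'$ is an extremal ternary $[36,18,12]$ code equivalent to the Pless symmetry code $C(17)$. (iii) The full (monomial) automorphism group of the code $L(17)$ coincides with the full automorphism group of $H$.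
   Context: All codes are over $GF(3)$; $-1$ is identified with $2$. For an odd prime power $q$ with $q\equiv -1\pmod 3$, $S_q=(s_{i,j})$ is the $(q+1)\times(q+1)$ matrix with rows and columns labeled by $\infty$ and the elements of $GF(q)$, where $s_{\infty,\infty}=0$, $s_{a,a}=0$, $s_{\infty,a}=1$ for $a\in GF(q)$, $s_{a,\infty}=1$ if $-1$ is a square in $GF(q)$ and $s_{a,\infty}=-1$ otherwise, and for $a\neq b$ in $GF(q)$, $s_{a,b}=1$ if $a-b$ is a square in $GF(q)$ and $s_{a,b}=-1$ otherwise. $U_q$ is obtained from $S_q$ by replacing every nonzero entry in the column labeled $\infty$ by $-1$. $L(q)$ is the ternary code with generator matrix $(I_{q+1},U_q)$; the Pless symmetry code $C(q)$ is the ternary code with generator matrix $(I_{q+1},S_q)$. A Hadamard matrix of order $n$ is an $n\times n$ $(\pm1)$-matrix $M$ with $MM^T=nI$; it is regular if all rows contain the same number of $-1$'s. Two Hadamard matrices $M_1,M_2$ are equivalent if $LM_1R=M_2$ for $\{0,\pm1\}$-monomial matrices $L,R$; an automorphism of $M$ is such a pair $(L,R)$ with $LMR=M$ (the automorphism group of $M$ acts on the coordinates via $R$). The Paley-Hadamard matrix of type II for $q\equiv1\pmod 4$ is $\begin{pmatrix} I+S_q & -I+S_q\\ -I+S_q & -I-S_q\end{pmatrix}$. The monomial automorphism group of a ternary code consists of monomial matrices over $GF(3)$ mapping the code onto itself. A ternary self-dual $[36,18,d]$ code is extremal if $d=12$. *)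

(* Defs.v *)
From HB Require Import structures.
From mathcomp Require Import all_boot all_order all_fingroup all_algebra.
Set Implicit Arguments.
Unset Strict Implicit.
Unset Printing Implicit Defensive.
Import Order.TTheory GRing.Theory Num.Theory.
Local Open Scope ring_scope.

(* The Paley-type matrices are (0,1,-1)-matrices over the integers; codes are
   generated by their reductions [mod3].  Rows and columns are indexed by 'I_n
   through a labelling [lab] by GF(q) extended with infinity, [None] being
   infinity.  [lab] is intended to be a bijection, so that n = q + 1. *)
Section PaleyMatrices.

Variables (F : finFieldType) (n : nat) (lab : 'I_n -> option F).

Definition is_square (x : F) : bool := [exists y : F, x == y ^+ 2].

Definition S_entry (u v : option F) : int :=
  match u, v with
  | None, None => 0
  | None, Some _ => 1
  | Some _, None => if is_square (- 1) then 1 else - 1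
  | Some a, Some b =>
      if a == b then 0 else if is_square (a - b) then 1 else - 1
  end.

Definition S_mx : 'M[int]_n := \matrix_(i, j) S_entry (lab i) (lab j).

Definition U_mx : 'M[int]_n :=
  \matrix_(i, j)
    if (lab j == None) && (S_mx i j != 0) then - 1 else S_mx i j.

Definition H_mx : 'M[int]_(n + n) :=
  block_mx (1%:M - U_mx^T) (U_mx + 1%:M)
           (1%:M + U_mx^T) (U_mx - 1%:M).

Definition paley2_mx : 'M[int]_(n + n) :=
  block_mx (1%:M + S_mx)     (- 1%:M + S_mx)
           (- 1%:M + S_mx)   (- 1%:M - S_mx).

Definition mod3 (m p : nat) (A : 'M[int]_(m, p)) : 'M['F_3]_(m, p) :=
  map_mx intr A.

Definition L_code : 'M['F_3]_(n, n + n) := row_mx 1%:M (mod3 U_mx).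

Definition pless_code : 'M['F_3]_(n, n + n) := row_mx 1%:M (mod3 S_mx).

End PaleyMatrices.

Definition label17 (i : 'I_18) : option 'F_17 :=
  omap (fun a : 'I_17 => (a : nat)%:R) (unlift ord0 i).

Definition H17 : 'M[int]_36 := H_mx label17.
Definition paley2_17 : 'M[int]_36 := paley2_mx label17.
Definition L17 : 'M['F_3]_(18, 36) := L_code label17.
Definition C17 : 'M['F_3]_(18, 36) := pless_code label17.

Definition monomial_mx (n : nat) (P : 'M['F_3]_n) : bool :=
  [forall i, #|[set j | P i j != 0]| == 1%N]
  && [forall j, #|[set i | P i j != 0]| == 1%N].

(* A (0,1,-1)-matrix over the integers is the entrywise lift of a unique matrix
   over GF(3), with 2 lifted to -1.  The monomial matrices acting on Hadamard
   matrices are represented in this way, which makes them a finite type; the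
   products in [hadamard_isom] are nevertheless taken over the integers. *)
Definition lift3 (n : nat) (P : 'M['F_3]_n) : 'M[int]_n :=
  map_mx (fun x : 'F_3 => if x == 0 then 0 else if x == 1 then 1 else - 1) P.

Section Hadamard.

Variable n : nat.
Implicit Types M A : 'M[int]_n.

Definition hadamard M : bool :=
  [forall i, forall j, (M i j == 1) || (M i j == - 1)]
  && (M *m M^T == (n%:R)%:M).

Definition regular M : bool :=
  [forall i, forall i',
     #|[set j | M i j == - 1]| == #|[set j | M i' j == - 1]|].

Definition hadamard_isom M1 M2 : {set 'M['F_3]_n * 'M['F_3]_n} :=
  [set LR | [&& monomial_mx LR.1, monomial_mx LR.2
              & lift3 LR.1 *m M1 *m lift3 LR.2 == M2]].

Definition hadamard_equiv M1 M2 : Prop :=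
  exists LR, LR \in hadamard_isom M1 M2.

Definition hadamard_aut M : {set 'M['F_3]_n * 'M['F_3]_n} :=
  hadamard_isom M M.

(* The integer division is exact when the entries of M are 1 or -1. *)
Definition hadamard_incidence M : 'M[int]_n :=
  map_mx (fun x : int => (x %/ 2)%Z) (M + const_mx 1).

(* Rows are blocks and columns are points. *)
Definition symmetric_2design (k lambda : nat) A : bool :=
  [&& [forall i, forall j, (A i j == 0) || (A i j == 1)],
      [forall i, \sum_j A i j == k%:R]
    & [forall j, forall j', (j != j') ==>
         (\sum_i A i j * A i j' == lambda%:R)]].

(* The point permutations that map blocks to blocks. *)
Definition design_aut A : {set 'S_n} :=
  [set s : 'S_n | [exists t : 'S_n, row_perm t (col_perm s A) == A]].

End Hadamard.

(* A ternary code of length n is the row space of a matrix with n columns. *)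
Section TernaryCodes.

Variable n : nat.

Definition wt (v : 'rV['F_3]_n) : nat := #|[set j | v 0 j != 0]|.

Definition min_distance (m : nat) (C : 'M['F_3]_(m, n)) (d : nat) : Prop :=
  (exists v : 'rV['F_3]_n, [/\ (v <= C)%MS, v != 0 & wt v = d])
  /\ (forall v : 'rV['F_3]_n, (v <= C)%MS -> v != 0 -> (d <= wt v)%N).

(* The row space of [kermx C^T] is the dual code of C. *)
Definition self_dual (m : nat) (C : 'M['F_3]_(m, n)) : bool :=
  (C == kermx C^T)%MS.

Definition code_equiv (m1 m2 : nat)
    (C1 : 'M['F_3]_(m1, n)) (C2 : 'M['F_3]_(m2, n)) : Prop :=
  exists P : 'M['F_3]_n, monomial_mx P /\ (C1 *m P == C2)%MS.

Definition code_aut (m : nat) (C : 'M['F_3]_(m, n)) : {set 'M['F_3]_n} :=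
  [set P | monomial_mx P && (C *m P == C)%MS].

Definition hadamard_in_code (m : nat) (C : 'M['F_3]_(m, n))
    (M : 'M[int]_n) : bool :=
  hadamard M
  && [forall i, (row i (mod3 M) <= C)%MS && (wt (row i (mod3 M)) == n)].

End TernaryCodes.

Definition extremal36 (m : nat) (C : 'M['F_3]_(m, 36)) : Prop :=
  [/\ self_dual C, \rank C = 18%N & min_distance C 12].

(* Main.v *)
(* The code L(17) has 444 codewords of weight 36 up to sign: the 36 rows of H
   and 408 others forming one orbit of the automorphism group.  Inner products of
   the 408 words with each other are 0, +-12 or +-36 and with the rows of H they
   are +-6, so H is the only Hadamard matrix using a row of H, and code
   automorphisms preserve it.  If the rows m_i of a Hadamard matrix are among the
   408 words, then sum_i <v,m_i><w,m_i> = 36 <v,w> for all words v, w.  These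
   linear equations in the indicator function of the set of rows leave 24
   solutions through a given word, which its stabilizer permutes simply
   transitively; this yields both the uniqueness of H' and the order 816 * 24 of
   the automorphism group.  Only the identity preserves H' up to signs and fixes the
   all-one word or a given row of H', which follows from invariants counting the
   values of the sums sum_j u_j v_j x_j y_j when x and y run over the rows of H'. *)

From Stdlib Require Import BinNat.
Require Import Defs.
From mathcomp Require Import all_boot all_order all_fingroup all_algebra.
From mathcomp Require Import zify ring.
Set Implicit Arguments.
Unset Strict Implicit.
Unset Printing Implicit Defensive.
Import Order.TTheory GRing.Theory Num.Theory.
Local Open Scope ring_scope.

(** * Monomial matrices *)

(** A codeword of weight 36 has no zero among its 18 information symbols, so up to sign all of them
    arise from 2^17 sign vectors. Transitivity on the 408 words reduces every statement about pairs
    of words to one about a single base word [w0]. The all-one word is a row of H. This explains why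
    H' is regular: its rows have inner product 6 or -6 with that word, so with suitable signs each
    has 21 entries -1 and 15 entries 1. It also puts (H' + J)/2, which is -(H' + J) modulo 3, inside
    the code, and it makes rigidity apply to the design, whose automorphisms fix the all-one word.
    Dividing inner products by 12 leaves equations with coefficients 0, +-1, +-3, +-9 in 0/1
    unknowns; a branching certificate with interval propagation solves them. For the minimum
    distance, U U^T = -I modulo 3 makes both halves of the coordinates information sets, and weights
    are multiples of 3; so only combinations of at most 4 rows need inspection. C(17) arises from
    L(17) by changing one sign. *)

Definition mono (R : pzRingType) n (s : 'S_n) (b : {ffun 'I_n -> bool}) : 'M[R]_n :=
  \matrix_(i, j) if j == s i then (-1) ^+ b i else 0.
Arguments mono {R n}.

Lemma mulmx_mono (R : pzRingType) m n (A : 'M[R]_(m, n)) s b i j :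
  (A *m mono s b) i j = A i (s^-1%g j) * (-1) ^+ b (s^-1%g j).
Proof.
rewrite mxE (bigD1 (s^-1%g j)) //= big1 ?addr0 => [|k kP].
  by rewrite !mxE permKV eqxx.
rewrite mxE ifN ?mulr0 //; apply: contra kP => /eqP ->.
by rewrite permK.
Qed.

Lemma mono_mul (R : pzRingType) n (s t : 'S_n) b c :
  mono s b *m mono t c = mono (s * t)%g [ffun i => b i (+) c (s i)] :> 'M[R]_n.
Proof.
apply/matrixP=> i j; rewrite mulmx_mono !mxE ffunE permM.
rewrite (canF_eq (permKV t)).
by case: eqP => [->|_]; rewrite ?mul0r ?permK // signr_addb.
Qed.

Lemma mono_tr (R : pzRingType) n (s : 'S_n) b :
  (mono s b)^T = mono s^-1%g [ffun i => b (s^-1%g i)] :> 'M[R]_n.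
Proof.
apply/matrixP=> i j; rewrite !mxE ffunE eq_sym (canF_eq (permK s)).
by case: eqP => [->|//].
Qed.

Lemma mono1 (R : pzRingType) n : mono 1%g [ffun=> false] = 1%:M :> 'M[R]_n.
Proof.
by apply/matrixP=> i j; rewrite !mxE ffunE perm1 expr0 eq_sym; case: eqP.
Qed.

Lemma mono_tr_mul (R : pzRingType) n (s : 'S_n) b :
  mono s b *m (mono s b)^T = 1%:M :> 'M[R]_n.
Proof.
rewrite mono_tr mono_mul mulgV -[RHS]mono1; congr mono.
by apply/ffunP => i; rewrite !ffunE permK addbb.
Qed.

Lemma F3_cases (x : 'F_3) : [|| x == 0, x == 1 | x == -1].
Proof. by case: x => [[|[|[|?]]]]. Qed.

Lemma card_eq1P (T : finType) (A : {set T}) : #|A| = 1%N -> exists x, A = [set x].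
Proof. by move/eqP/cards1P. Qed.

Lemma monomialP n (P : 'M['F_3]_n) :
  reflect (exists s b, P = mono s b) (monomial_mx P).
Proof.
apply: (iffP andP) => [[/forallP rP /forallP cP]|[s [b ->]]]; last first.
  split; apply/forallP=> i.
    rewrite (_ : [set j | _] = [set s i]) ?cards1 //.
    apply/setP=> j; rewrite !inE !mxE; case: (j =P s i) => // _.
    by rewrite signr_eq0.
  rewrite (_ : [set j | _] = [set s^-1%g i]) ?cards1 //.
  apply/setP=> j; rewrite !inE !mxE -(canF_eq (permK s)) [s j == i]eq_sym.
  by case: (i =P s j) => // _; rewrite signr_eq0.
have ex i : exists j, P i j != 0.
  have /eqP/card_eq1P[j] := rP i.
  by move/setP/(_ j); rewrite !inE eqxx => ?; exists j.
pose f i := xchoose (ex i).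
have fP i : P i (f i) != 0 by exact: (xchooseP (ex i)).
have f_inj : injective f.
  move=> i k eq_f; have /eqP/card_eq1P[l /setP lP] := cP (f i).
  have:= lP i; have:= lP k; rewrite !inE eq_f fP -eq_f fP.
  by move=> /esym/eqP-> /esym/eqP->.
exists (perm f_inj), [ffun i => P i (f i) == -1].
apply/matrixP=> i j; rewrite mxE ffunE permE.
case: eqP => [->|/eqP ne].
  by move: (fP i); case/or3P: (F3_cases (P i (f i))) => /eqP->.
have /eqP/card_eq1P[l /setP lP] := rP i.
apply/eqP; apply/negPn/negP=> nz.
have:= lP j; have:= lP (f i); rewrite !inE fP nz => /esym/eqP E1 /esym/eqP E2.
by rewrite E1 E2 eqxx in ne.
Qed.

(** One pair of a permutation and signs describes the matrix over GF(3) and its integer lift; this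
    is why [mono] is defined over an arbitrary ring. *)
Lemma lift3_mono n (s : 'S_n) b : lift3 (mono s b) = mono s b.
Proof.
apply/matrixP=> i j; rewrite !mxE; case: (j =P s i) => // _.
by case: (b i); rewrite ?expr0 ?expr1.
Qed.

Lemma mod3_lift3 n (P : 'M['F_3]_n) : mod3 (lift3 P) = P.
Proof.
apply/matrixP=> i j; rewrite !mxE.
by case/or3P: (F3_cases (P i j)) => /eqP->.
Qed.

Lemma mod3M m n p (A : 'M[int]_(m, n)) (B : 'M_(n, p)) :
  mod3 (A *m B) = mod3 A *m mod3 B.
Proof. exact: map_mxM. Qed.

Lemma monomial_mul n (P Q : 'M['F_3]_n) :
  monomial_mx P -> monomial_mx Q -> monomial_mx (P *m Q).
Proof.
move=> /monomialP[s [b ->]] /monomialP[t [c ->]]; rewrite mono_mul.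
by apply/monomialP; do 2![eexists].
Qed.

Lemma monomial_tr n (P : 'M['F_3]_n) : monomial_mx P -> monomial_mx P^T.
Proof.
move=> /monomialP[s [b ->]]; rewrite mono_tr.
by apply/monomialP; do 2![eexists].
Qed.

Lemma monomial_mulT n (P : 'M['F_3]_n) : monomial_mx P -> P *m P^T = 1%:M.
Proof. by move=> /monomialP[s [b ->]]; rewrite mono_tr_mul. Qed.

Lemma monomial_Tmul n (P : 'M['F_3]_n) : monomial_mx P -> P^T *m P = 1%:M.
Proof. by move/monomial_tr/monomial_mulT; rewrite trmxK. Qed.

Lemma lift3_tr n (P : 'M['F_3]_n) : lift3 P^T = (lift3 P)^T.
Proof. by rewrite /lift3 map_trmx. Qed.

Lemma lift3_mulT n (P : 'M['F_3]_n) :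
  monomial_mx P -> lift3 P *m (lift3 P)^T = 1%:M.
Proof. by move=> /monomialP[s [b ->]]; rewrite lift3_mono mono_tr_mul. Qed.

(** Entrywise lifting is not multiplicative in general. Here each entry of the product has at most
    one nonzero term, so nothing is reduced modulo 3. *)
Lemma lift3_mul n (P Q : 'M['F_3]_n) : monomial_mx P -> monomial_mx Q ->
  lift3 (P *m Q) = lift3 P *m lift3 Q.
Proof.
move=> /monomialP[s [b ->]] /monomialP[t [c ->]].
by rewrite mono_mul !lift3_mono mono_mul.
Qed.

Lemma lift3_inj n : injective (@lift3 n).
Proof. by move=> P Q /(congr1 (@mod3 _ _)); rewrite !mod3_lift3. Qed.

Lemma monomial_unit n (P : 'M['F_3]_n) : monomial_mx P -> P \in unitmx.
Proof. by move=> /monomial_mulT/mulmx1_unit[]. Qed.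

(** * Sign vectors *)

(* Signs are encoded by booleans: [true] stands for -1. *)
Definition sgv n (s : seq bool) : 'rV[int]_n := \row_j (-1) ^+ nth false s j.

Definition ip n (u v : 'rV[int]_n) : int := (u *m v^T) 0 0.

Lemma ipE n (u v : 'rV[int]_n) : ip u v = \sum_j u 0 j * v 0 j.
Proof. by rewrite /ip mxE; apply: eq_bigr => j _; rewrite mxE. Qed.

Lemma ipC n (u v : 'rV[int]_n) : ip u v = ip v u.
Proof. by rewrite !ipE; apply: eq_bigr => j _; rewrite mulrC. Qed.

Lemma ipZl n a (u v : 'rV[int]_n) : ip (a *: u) v = a * ip u v.
Proof. by rewrite /ip -scalemxAl mxE. Qed.

Lemma ipZr n a (u v : 'rV[int]_n) : ip u (a *: v) = a * ip u v.
Proof. by rewrite ipC ipZl ipC. Qed.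

Lemma ip_monomial n (P : 'M['F_3]_n) u v : monomial_mx P ->
  ip (u *m lift3 P) (v *m lift3 P) = ip u v.
Proof.
by move=> mP; rewrite /ip trmx_mul mulmxA -(mulmxA u) lift3_mulT // mulmx1.
Qed.

Fixpoint dis (s t : seq bool) : nat :=
  match s, t with
  | a :: s', b :: t' => if a then (if b then dis s' t' else (dis s' t').+1)
                        else (if b then (dis s' t').+1 else dis s' t')
  | _, _ => 0%N
  end.

Lemma ip_sgv n s t : size s = n -> size t = n ->
  ip (sgv n s) (sgv n t) = n%:Z - (2 * dis s t)%:Z.
Proof.
rewrite ipE; under eq_bigr do rewrite !mxE.
elim: n s t => [|n IHn] [|a s] [|b t] //=; first by rewrite big_ord0.
move=> [ss] [st]; rewrite big_ord_recl /= IHn //.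
by case: a; case: b; rewrite ?expr0 ?expr1; lia.
Qed.

(* Entry k of the list encodes column k: the code 2i + e stands for an entry
   (-1)^e in row i. *)
Definition gmx n (g : seq nat) : 'M['F_3]_n :=
  \matrix_(i, k) if i == (nth 0%N g k)./2 :> nat
                 then (-1) ^+ odd (nth 0%N g k) else 0.

Definition act (g : seq nat) (s : seq bool) : seq bool :=
  [seq nth false s c./2 (+) odd c | c <- g].

Definition sperm n (g : seq nat) : bool := perm_eq [seq c./2 | c <- g] (iota 0 n).

Lemma gmx_mono n g : sperm n g -> exists s b, gmx n g = mono s b.
Proof.
move=> gP; have sg : size g = n.
  by rewrite -(size_map half) (perm_size gP) size_iota.
have lt_g (k : 'I_n) : ((nth 0%N g k)./2 < n)%N.
  have: (nth 0%N g k)./2 \in iota 0 n.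
    by rewrite -(perm_mem gP) map_f // mem_nth // sg.
  by rewrite mem_iota.
pose f k := Ordinal (lt_g k).
have f_inj : injective f.
  move=> i j /(congr1 val) /= eq_f; apply/val_inj/eqP => /=.
  have u : uniq [seq c./2 | c <- g] by rewrite (perm_uniq gP) iota_uniq.
  by rewrite -(nth_uniq 0%N _ _ u) ?size_map ?sg // !(nth_map 0%N) ?sg // eq_f.
(* [f] sends a column to the row of its nonzero entry, while [mono] sends rows to columns; hence the
   inverse. *)
exists (perm f_inj)^-1%g, [ffun i => odd (nth 0%N g ((perm f_inj)^-1%g i))].
apply/matrixP=> i j; rewrite !mxE ffunE.
rewrite -[j == _](inj_eq (@perm_inj _ (perm f_inj))) permKV permE -val_eqE /=.
rewrite [in RHS]eq_sym; case: (i =P _ :> nat) => // eq_i.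
suff -> : (perm f_inj)^-1%g i = j by [].
by apply: (@perm_inj _ (perm f_inj)); rewrite permKV permE; apply: val_inj.
Qed.

Lemma gmx_monomial n g : sperm n g -> monomial_mx (gmx n g).
Proof. by move=> /gmx_mono[s [b ->]]; apply/monomialP; do 2![eexists]. Qed.

Lemma sgv_act n g s : sperm n g -> sgv n s *m lift3 (gmx n g) = sgv n (act g s).
Proof.
move=> gP; have sg : size g = n.
  by rewrite -(size_map half) (perm_size gP) size_iota.
apply/rowP=> k; rewrite !mxE (nth_map 0%N) ?sg //.
have lt_g : ((nth 0%N g k)./2 < n)%N.
  have: (nth 0%N g k)./2 \in iota 0 n.
    by rewrite -(perm_mem gP) map_f // mem_nth // sg.
  by rewrite mem_iota.
rewrite (bigD1 (Ordinal lt_g)) //= big1 ?addr0 => [|i ne]; last first.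
  rewrite [in X in _ * X]mxE (_ : gmx n g i k = 0) ?eqxx ?mulr0 // mxE.
  by rewrite ifN //; apply: contra ne => /eqP eq_i; apply/eqP/val_inj.
rewrite !mxE eqxx /= signr_addb; congr (_ * _).
by case: (odd _).
Qed.

(** Supplies the left factor of an equivalence, so that only the action on columns has to be
    studied. *)
Lemma row_monomial n (A B : 'M[int]_n) (f : 'I_n -> 'I_n) (b : 'I_n -> bool) :
  injective f -> (forall i, row i A = (-1) ^+ b i *: row (f i) B) ->
  exists2 L : 'M['F_3]_n, monomial_mx L & lift3 L *m A = B.
Proof.
move=> f_inj rA; exists (mono (perm f_inj) [ffun i => b i])^T.
  by apply/monomial_tr/monomialP; do 2![eexists].
have -> : A = lift3 (mono (perm f_inj) [ffun i => b i]) *m B.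
  apply/row_matrixP=> i; rewrite rA row_mul lift3_mono; apply/rowP=> j.
  rewrite !mxE (bigD1 (f i)) //= big1 ?addr0 => [|k ne].
    by rewrite !mxE permE eqxx ffunE.
  by rewrite !mxE permE ifN // mul0r.
rewrite mulmxA lift3_tr (mulmx1C (lift3_mulT _)) ?mul1mx //.
by apply/monomialP; do 2![eexists].
Qed.

Lemma ip_row n (M N : 'M[int]_n) i j : ip (row i M) (row j N) = (M *m N^T) i j.
Proof. by rewrite ipE mxE; apply: eq_bigr => k _; rewrite !mxE. Qed.

Lemma hadamard_ip n (M : 'M[int]_n) i j : hadamard M ->
  ip (row i M) (row j M) = n%:R *+ (i == j).
Proof. by move=> /andP[_ /eqP eqM]; rewrite ip_row eqM !mxE. Qed.

Lemma hadamard_parseval n (M : 'M[int]_n) u v : hadamard M ->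
  \sum_i ip u (row i M) * ip v (row i M) = n%:R * ip u v.
Proof.
move=> /andP[_ /eqP eqM]; have eqM' : M^T *m M = n%:R%:M.
  case: n M u v eqM => [|n] M u v eqM; first by rewrite !flatmx0.
  have inj : injective (map_mx (intr : int -> rat) : 'M_n.+1 -> 'M_n.+1).
    by move=> A B /matrixP eqAB; apply/matrixP=> i j; have:= eqAB i j; rewrite !mxE => /intr_inj.
  apply: inj; rewrite map_mxM map_scalar_mx.
  (* Over the rationals M^T / n is a right inverse of M, hence also a left one; so the columns are
     orthogonal too. *)
  have: map_mx intr M *m (n.+1%:R^-1 *: map_mx intr M^T) = 1%:M :> 'M[rat]_n.+1.
    rewrite -scalemxAr -map_mxM eqM map_scalar_mx scale_scalar_mx.
    by rewrite rmorph_nat mulVf ?pnatr_eq0.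
  move/mulmx1C; rewrite -scalemxAl => /(congr1 (fun X => n.+1%:R *: X)).
  by rewrite scalerA mulfV ?pnatr_eq0 // scale1r scalemx1 rmorph_nat.
have ipM w i : ip w (row i M) = (w *m M^T) 0 i.
  by rewrite ipE mxE; apply: eq_bigr => k _; rewrite !mxE.
transitivity (ip (u *m M^T) (v *m M^T)).
  by rewrite [RHS]ipE; apply: eq_bigr => i _; rewrite !ipM.
rewrite /ip trmx_mul trmxK mulmxA -(mulmxA u) eqM' mul_mx_scalar -scalemxAl.
by rewrite mxE.
Qed.

(** * Ternary vectors *)

(* GF(3) as [option bool]: [None] is 0 and [Some b] is (-1)^b. *)
Definition trit := option bool.

Definition tF (t : trit) : 'F_3 := if t is Some b then (-1) ^+ b else 0.
Definition tZ (t : trit) : int := if t is Some b then (-1) ^+ b else 0.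

Definition tadd (s t : trit) : trit :=
  match s, t with
  | None, _ => t
  | _, None => s
  | Some true, Some true => Some false
  | Some false, Some false => Some true
  | _, _ => None
  end.

Definition tmul (s t : trit) : trit :=
  if s is Some a then if t is Some b then Some (a (+) b) else None else None.

Lemma tF_add s t : tF (tadd s t) = tF s + tF t.
Proof. by apply/val_inj; move: s t => [[]|] [[]|]. Qed.

Lemma tF_mul s t : tF (tmul s t) = tF s * tF t.
Proof. by apply/val_inj; move: s t => [[]|] [[]|]. Qed.

Lemma tF_inj : injective tF.
Proof. by move=> [[]|] [[]|] // /(congr1 val). Qed.

Lemma tF_surj x : exists t, x == tF t.
Proof.
by case/or3P: (F3_cases x) => /eqP ->; [exists None|exists (Some false)|exists (Some true)].
Qed.

Lemma intr_tZ t : (tZ t)%:~R = tF t.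
Proof. by case: t => [[]|]; rewrite ?rmorph0 ?rmorph1 ?rmorphN1. Qed.

Definition trow n (l : seq trit) : 'rV['F_3]_n := \row_j tF (nth None l j).

Lemma trow_inj n k l : size k = n -> size l = n -> trow n k = trow n l -> k = l.
Proof.
move=> sk sl /rowP eq_kl; apply: (@eq_from_nth _ None) => [|i]; rewrite sk ?sl //.
by move=> lt_i; have := eq_kl (Ordinal lt_i); rewrite !mxE => /tF_inj.
Qed.

Lemma trow_surj n (v : 'rV['F_3]_n) : exists2 l, size l = n & v = trow n l.
Proof.
pose t x := xchoose (tF_surj x).
have tP x : tF (t x) = x by rewrite -(eqP (xchooseP (tF_surj x))).
exists [seq t (v 0 j) | j <- enum 'I_n]; first by rewrite size_map size_enum_ord.
apply/rowP=> j; rewrite mxE (nth_map j) ?size_enum_ord //.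
by rewrite nth_ord_enum tP.
Qed.

Fixpoint taddl (k l : seq trit) : seq trit :=
  match k, l with
  | s :: k', t :: l' => tadd s t :: taddl k' l'
  | _, _ => [::]
  end.

Fixpoint comb (x : seq trit) (R : seq (seq trit)) (acc : seq trit) : seq trit :=
  match x, R with
  | a :: x', r :: R' => comb x' R' (taddl acc (map (tmul a) r))
  | _, _ => acc
  end.

Lemma size_taddl k l : size k = size l -> size (taddl k l) = size l.
Proof. by elim: k l => [|s k IHk] [|t l] //= [/IHk->]. Qed.

Lemma size_comb n x R acc : size acc = n -> all (fun r => size r == n) R ->
  size (comb x R acc) = n.
Proof.
elim: R x acc => [|r R IHR] [|a x] acc //= sacc /andP[/eqP sr sR].
by apply: IHR => //; rewrite size_taddl size_map sr.
Qed.

Lemma trow_add n k l : size k = n -> size l = n ->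
  trow n (taddl k l) = trow n k + trow n l.
Proof.
move=> sk sl; apply/rowP=> j; rewrite !mxE -tF_add; congr tF.
have : size k = size l by rewrite sk.
have : (j < size l)%N by rewrite sl.
move: (nat_of_ord j) => {sk sl}j; elim: k l j => [|s k IHk] [|t l] [|j] //=.
by move=> lt_j [skl]; apply: IHk.
Qed.

Lemma trow_mul n a l : trow n (map (tmul a) l) = tF a *: trow n l.
Proof.
apply/rowP=> j; rewrite !mxE -tF_mul; congr tF.
have [lt_j|ge_j] := ltnP j (size l); first by rewrite (nth_map None).
by rewrite !nth_default ?size_map //; case: a.
Qed.

Lemma trow_comb m n (x : seq trit) (R : seq (seq trit)) acc :
    size x = m -> size R = m -> size acc = n -> all (fun r => size r == n) R ->
  trow n (comb x R acc) =
    trow n acc + trow m x *m \matrix_i trow n (nth [::] R i).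
Proof.
elim: R m x acc => [|r R IHR] m [|a x] acc /= <- //; first by rewrite mulmx_sum_row big_ord0 addr0.
move=> [sR] sacc /andP[/eqP sr sRn]; rewrite (IHR (size x)) // ?size_taddl ?size_map ?sr //.
rewrite trow_add ?size_map // trow_mul -addrA; congr (_ + _).
rewrite !mulmx_sum_row big_ord_recl !mxE /= rowK; congr (_ + _).
by apply: eq_bigr => i _; rewrite !mxE !rowK.
Qed.

Definition mk_table T (f : nat -> nat -> T) (m n : nat) : seq (seq T) :=
  mkseq (fun i => mkseq (f i) n) m.

Lemma nth_table T (x0 : T) f m n (i : 'I_m) (j : 'I_n) :
  nth x0 (nth [::] (mk_table f m n) i) j = f i j.
Proof. by rewrite !nth_mkseq. Qed.

(** * The matrices S, U and H *)

(** 0 is listed because [is_square] holds at 0. *)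
Definition squares17 := [:: 0; 1; 2; 4; 8; 9; 13; 15; 16]%N.

(** Index 0 is infinity and i > 0 is the field element i - 1, so differences of indices are
    differences of elements; adding 17 keeps the subtraction in nat exact. Column 0 has entries 1
    because -1 is a square modulo 17. *)
Definition S_trit (i j : nat) : trit :=
  match i, j with
  | 0, 0 => None
  | 0, _ | _, 0 => Some false
  | _, _ => if i == j then None else Some ((i + 17 - j) %% 17 \notin squares17)
  end%N.

Definition U_trit (i j : nat) : trit :=
  if (j == 0)%N && (S_trit i j != None) then Some true else S_trit i j.

Lemma is_square17 (x : 'F_17) : is_square x = (val x \in squares17).
Proof.
have -> : is_square x = has (fun m => x == (m%:R) ^+ 2) (iota 0 17).
  apply/existsP/hasP => [[y eq_x]|[m _ eq_x]]; last by exists m%:R.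
  by exists (val y); rewrite ?natr_Zp // mem_iota ltn_ord.
have: all (fun k : nat => has (fun m => (k%:R : 'F_17) == m%:R ^+ 2) (iota 0 17)
          == (k \in squares17)) (iota 0 17) by vm_compute.
move/allP/(_ (val x)); rewrite mem_iota ltn_ord natr_Zp => /(_ isT).
by move/eqP.
Qed.

Lemma S_mx17 (i j : 'I_18) : S_mx label17 i j = tZ (S_trit i j).
Proof.
rewrite mxE /label17; case: unliftP => [a|] ->; case: unliftP => [b|] -> //=.
  rewrite /bump /= !add1n eqSS.
  have valF (k : nat) : (k%:R : 'F_17) = (k %% 17)%N :> nat by rewrite val_Fp_nat.
  have -> : ((a%:R : 'F_17) == b%:R) = (a == b :> nat).
    by rewrite -(inj_eq val_inj) /= !valF !modn_small.
  case: eqP => // _.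
  have -> : (a%:R - b%:R : 'F_17) = (a.+1 + 17 - b.+1)%:R.
    by rewrite addSn subSS natrB ?natrD ?(leq_trans (ltnW (ltn_ord b))) ?leq_addl //
      (_ : 17%:R = 0 :> 'F_17) ?addr0 //; apply/val_inj.
  by rewrite is_square17 /= valF; case: (_ \in _).
by rewrite is_square17.
Qed.

Lemma label17_eq0 (j : 'I_18) : (label17 j == None) = (j == 0%N :> nat).
Proof. by rewrite /label17; case: unliftP => [a|] ->. Qed.

Lemma U_mx17 (i j : 'I_18) : U_mx label17 i j = tZ (U_trit i j).
Proof.
rewrite mxE label17_eq0 S_mx17 /U_trit (_ : (tZ (S_trit i j) != 0) = (S_trit i j != None)).
  by case: andP.
by case: (S_trit i j) => [[]|].
Qed.

Lemma forall_ordP n (f : nat -> bool) :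
  all f (iota 0 n) -> forall i : 'I_n, f i.
Proof. by move=> /allP fP i; apply: fP; rewrite mem_iota ltn_ord. Qed.

Lemma forall_ord2P n (f : nat -> nat -> bool) :
  all (fun i => all (f i) (iota 0 n)) (iota 0 n) -> forall i j : 'I_n, f i j.
Proof. by move/(@forall_ordP n) => fP i; apply/forall_ordP/fP. Qed.

Lemma ut_diag (i j : 'I_18) : (U_trit i j == None) = (i == j).
Proof.
have ut_ok : all (fun i => all (fun j => (U_trit i j == None) == (i == j)) (iota 0 18)) (iota 0 18).
  by vm_compute.
by have /eqP := forall_ord2P ut_ok i j.
Qed.

Definition U_rows : seq (seq trit) := mk_table U_trit 18 18.

Lemma mod3_U : mod3 (U_mx label17) = \matrix_i trow 18 (nth [::] U_rows i).
Proof.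
by apply/matrixP=> i j; rewrite [LHS]mxE U_mx17 intr_tZ 2!mxE nth_table.
Qed.

Lemma size_UT : all (fun r => size r == 18%N) U_rows.
Proof. by vm_compute. Qed.

(* Since U and S have zeros exactly on the diagonal, in each of the sums below
   only one of the two summands is nonzero. *)
Definition H17_sign (i j : nat) : bool :=
  if (i < 18)%N then
    if (j < 18)%N then U_trit j i == Some false else U_trit i (j - 18) == Some true
  else
    if (j < 18)%N then U_trit j (i - 18) == Some true
    else U_trit (i - 18) (j - 18) != Some false.

Definition paley_sign (i j : nat) : bool :=
  if (i < 18)%N then
    if (j < 18)%N then S_trit i j == Some true else S_trit i (j - 18) != Some false
  else
    if (j < 18)%N then S_trit (i - 18) j != Some false
    else S_trit (i - 18) (j - 18) != Some true.

Definition bmx n (T : seq (seq bool)) : 'M[int]_n :=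
  \matrix_i sgv n (nth [::] T i).

Definition H17_rows : seq (seq bool) := mk_table H17_sign 36 36.
Definition paley_rows : seq (seq bool) := mk_table paley_sign 36 36.

Lemma H17E : H17 = bmx 36 H17_rows.
Proof.
have uE (i j : 'I_18) : (if (label17 j == None) && (S_entry (label17 i) (label17 j) != 0)
    then -1 else S_entry (label17 i) (label17 j)) = tZ (U_trit i j).
  by rewrite -U_mx17 2!mxE.
apply/matrixP=> i j; rewrite [RHS]mxE [RHS]mxE nth_table /H17_sign.
rewrite /H17 /H_mx mxE; case: splitP => i' ->; rewrite mxE; case: splitP => j' ->;
  rewrite 2!mxE ?[in X in X - _]mxE ?[in X in _ + X]mxE ?[in X in X + _]mxE.
all: rewrite ?[in X in - X]mxE uE ?ltn_ord ?[(18 + _ < 18)%N]ltnNge ?leq_addr /= ?addKn.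
- by rewrite eq_sym -ut_diag; case: (U_trit _ _) => [[]|].
- by rewrite -ut_diag; case: (U_trit _ _) => [[]|].
- by rewrite eq_sym -ut_diag; case: (U_trit _ _) => [[]|].
- by rewrite -ut_diag; case: (U_trit _ _) => [[]|].
Qed.

Lemma st_diag (i j : 'I_18) : (S_trit i j == None) = (i == j).
Proof.
have st_ok : all (fun i => all (fun j => (S_trit i j == None) == (i == j)) (iota 0 18)) (iota 0 18).
  by vm_compute.
by have /eqP := forall_ord2P st_ok i j.
Qed.

Lemma paley2_17E : paley2_17 = bmx 36 paley_rows.
Proof.
have sE (i j : 'I_18) : S_entry (label17 i) (label17 j) = tZ (S_trit i j).
  by rewrite -S_mx17 mxE.
apply/matrixP=> i j; rewrite [RHS]mxE [RHS]mxE nth_table /paley_sign.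
rewrite /paley2_17 /paley2_mx mxE; case: splitP => i' ->; rewrite mxE; case: splitP => j' ->.
all: rewrite !mxE sE ?ltn_ord ?[(18 + _ < 18)%N]ltnNge ?leq_addr /= ?addKn -st_diag.
all: by case: (S_trit _ _) => [[]|].
Qed.

Definition had_ok (T : seq (seq bool)) : bool :=
  all (fun i => all (fun j => dis (nth [::] T i) (nth [::] T j)
                       == if i == j then 0 else 18)%N (iota 0 36)) (iota 0 36)
  && all (fun s => size s == 36%N) T && (size T == 36%N).

Lemma nth_size T (P : pred (seq T)) (W : seq (seq T)) i :
  all P W -> (i < size W)%N -> P (nth [::] W i).
Proof. by move=> /all_nthP; apply. Qed.

Lemma row_bmx n T (i : 'I_n) : row i (bmx n T) = sgv n (nth [::] T i).
Proof. exact: rowK. Qed.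

Lemma had_okP T : had_ok T -> hadamard (bmx 36 T).
Proof.
move=> /andP[/andP[dT sT] /eqP nT]; apply/andP; split.
  by apply/forallP=> i; apply/forallP=> j; rewrite !mxE; case: nth.
apply/eqP/matrixP=> i j; rewrite -ip_row !row_bmx.
have sz (k : 'I_36) : size (nth [::] T k) = 36%N.
  by apply/eqP/(nth_size sT); rewrite nT.
rewrite ip_sgv ?sz // (eqP (forall_ord2P dT i j)) !mxE -val_eqE /=.
by case: eqP.
Qed.

Lemma HW_ok : had_ok H17_rows. Proof. by vm_compute. Qed.
Lemma PW_ok : had_ok paley_rows. Proof. by vm_compute. Qed.

(** The generator matrix is systematic: the right half of a codeword is its left half times U. *)
Definition incode (s : seq bool) : bool :=
  map Some (drop 18 s) == comb (map Some (take 18 s)) U_rows (nseq 18 None).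

Lemma L17_trow k l : size k = 18%N -> size l = 18%N ->
  (row_mx (trow 18 k) (trow 18 l) <= L17)%MS = (l == comb k U_rows (nseq 18 None)).
Proof.
move=> sk sl; have uE : trow 18 (comb k U_rows (nseq 18 None)) = trow 18 k *m mod3 (U_mx label17).
  rewrite (@trow_comb 18) ?size_nseq ?size_UT // mod3_U.
  rewrite (_ : trow 18 (nseq 18 None) = 0) ?add0r //.
  by apply/rowP=> j; rewrite !mxE nth_nseq ltn_ord.
have sc : size (comb k U_rows (nseq 18 None)) = 18%N.
  by rewrite (@size_comb 18) ?size_nseq ?size_UT.
apply/submxP/eqP => [[D]|->].
  rewrite /L17 /L_code mul_mx_row mulmx1 => /eq_row_mx[<-]; rewrite -uE.
  exact: trow_inj.
by exists (trow 18 k); rewrite /L17 /L_code mul_mx_row mulmx1 uE.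
Qed.

Lemma sgv_split s : size s = 36%N ->
  mod3 (sgv 36 s) = row_mx (trow 18 (map Some (take 18 s))) (trow 18 (map Some (drop 18 s)))
    :> 'rV_(18 + 18).
Proof.
move=> ss; apply/rowP=> j; rewrite [RHS]mxE [LHS]mxE [in LHS]mxE rmorphXn rmorphN1.
case: splitP => j' ->; rewrite mxE (nth_map false) ?size_take ?size_drop ?ss //=.
  by rewrite nth_take.
by rewrite nth_drop.
Qed.

Lemma incodeP s : size s = 36%N -> (mod3 (sgv 36 s) <= L17)%MS = incode s.
Proof.
by move=> ss; rewrite [mod3 _]sgv_split // L17_trow ?size_map ?size_take ?size_drop ?ss.
Qed.

(** * The words of weight 36 *)

Lemma HW_incode : all incode H17_rows. Proof. by vm_compute. Qed.

(** Lets invariance and self-orthogonality of the code be read off from the rows of H. *)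
Lemma mod3_H17 : (mod3 H17 == L17)%MS.
Proof.
have addF3 m n (A : 'M['F_3]_(m, n)) : - (A + A) = A.
  by apply/matrixP=> i j; rewrite !mxE; case/or3P: (F3_cases (A i j)) => /eqP->;
    apply/val_inj.
have H17F : mod3 H17 = block_mx (1%:M - (mod3 (U_mx label17))^T) (mod3 (U_mx label17) + 1%:M)
           (1%:M + (mod3 (U_mx label17))^T) (mod3 (U_mx label17) - 1%:M) :> 'M_(18 + 18).
  rewrite /H17 /H_mx /mod3 [LHS](@map_block_mx _ _ intr 18 18 18 18).
  by rewrite !raddfD /= !raddfN /= !map_mx1 map_trmx.
apply/andP; split; last first.
  (* The two block rows of H add up to 2 (I, U), which is -(I, U) modulo 3. *)
  apply/submxP; exists (- row_mx 1%:M 1%:M).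
  rewrite H17F mulNmx [X in - X](@mul_row_block _ 18 18 18 18 18) !mul1mx.
  by rewrite addrACA addNr addr0 addrACA subrr addr0 [RHS](@opp_row_mx _ 18 18 18) !addF3.
apply/row_subP=> i; rewrite /mod3 -map_row -/(mod3 _) H17E row_bmx incodeP; last first.
  by case/andP: HW_ok => /andP[_ sW] /eqP nW; apply/eqP/(nth_size sW); rewrite nW.
by apply: (nth_size HW_incode); rewrite size_mkseq.
Qed.

Definition cword (v : 'rV[int]_36) : bool :=
  [forall j, (v 0 j == 1) || (v 0 j == -1)] && (mod3 v <= L17)%MS.

Lemma hadamard_in_codeE M :
  hadamard_in_code L17 M = hadamard M && [forall i, cword (row i M)].
Proof.
rewrite /hadamard_in_code; case hM: (hadamard M) => //=; apply: eq_forallb => i.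
rewrite /cword -map_row; have pm : [forall j, (row i M 0 j == 1) || (row i M 0 j == -1)].
  by apply/forallP=> j; rewrite mxE; case/andP: hM => /forallP/(_ i)/forallP/(_ j).
rewrite pm [in RHS]andTb /wt; case: (_ <= _)%MS => //=.
rewrite -[X in _ == X]card_ord -cardsT; apply/eqP; congr #|pred_of_set _|; apply/setP=> j.
by rewrite !inE mxE; case/orP: (forallP pm j) => /eqP ->.
Qed.

Lemma code_autP P :
  reflect (monomial_mx P /\ (L17 *m P == L17)%MS) (P \in code_aut L17).
Proof. by rewrite inE; apply: andP. Qed.

(** Monomial matrices are invertible, so containment is equality by dimension. *)
Lemma code_aut_sub P : monomial_mx P -> (mod3 H17 *m P <= L17)%MS -> P \in code_aut L17.
Proof.
move=> mP sHP; apply/code_autP; split=> //.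
have sLP : (L17 *m P <= L17)%MS.
  by apply: submx_trans sHP; rewrite submxMr //; case/andP: mod3_H17.
rewrite -(geq_leqif (mxrank_leqif_eq sLP)) mxrankMfree //.
by rewrite row_free_unit monomial_unit.
Qed.

Definition gen_ok (g : seq nat) : bool :=
  sperm 36 g && all (fun s => incode (act g s)) H17_rows.

Lemma gen_okP g : gen_ok g -> gmx 36 g \in code_aut L17.
Proof.
move=> /andP[gP /allP cg]; apply: code_aut_sub; first exact: gmx_monomial.
apply/row_subP=> i; rewrite row_mul -[gmx 36 g]mod3_lift3 -map_row H17E row_bmx -/(mod3 _).
rewrite -mod3M sgv_act // incodeP; first by rewrite cg // mem_nth // size_mkseq.
by rewrite size_map -(size_map half) (perm_size gP) size_iota.
Qed.

Lemma code_aut_mul P Q :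
  P \in code_aut L17 -> Q \in code_aut L17 -> P *m Q \in code_aut L17.
Proof.
move=> /code_autP[mP eP] /code_autP[mQ eQ]; apply/code_autP; split.
  exact: monomial_mul.
by apply/eqmxP; rewrite mulmxA; apply: eqmx_trans (eqmxMr _ (eqmxP eP)) (eqmxP eQ).
Qed.

Lemma code_aut_tr P : P \in code_aut L17 -> P^T \in code_aut L17.
Proof.
move=> /code_autP[mP eP]; apply/code_autP; split; first exact: monomial_tr.
apply/eqmxP/eqmx_sym.
by have := eqmxMr P^T (eqmxP eP); rewrite -mulmxA monomial_mulT // mulmx1.
Qed.

Lemma code_aut_opp P : P \in code_aut L17 -> - P \in code_aut L17.
Proof.
move=> /code_autP[mP eP]; apply/code_autP; split.
  case/monomialP: mP => s [b ->]; apply/monomialP; exists s, [ffun i => ~~ b i].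
  apply/matrixP=> i j; rewrite !mxE ffunE; case: (j =P s i); rewrite ?oppr0 //.
  by rewrite signrN.
by apply/eqmxP; rewrite mulmxN; apply: eqmx_trans (eqmx_opp _) (eqmxP eP).
Qed.

Lemma code_aut1 : 1%:M \in code_aut L17.
Proof.
apply/code_autP; split; last by rewrite mulmx1; apply/eqmxP.
by rewrite -mono1; apply/monomialP; do 2![eexists].
Qed.

Lemma lift3N n (P : 'M['F_3]_n) : lift3 (- P) = - lift3 P.
Proof.
apply/matrixP=> i j; rewrite !mxE.
by case/or3P: (F3_cases (P i j)) => /eqP->.
Qed.

Lemma cword_aut P v : P \in code_aut L17 -> cword v -> cword (v *m lift3 P).
Proof.
move=> /code_autP[mP eP] /andP[/forallP pm cv]; apply/andP; split.
  case/monomialP: mP => s [b ->]; apply/forallP=> j; rewrite lift3_mono mulmx_mono.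
  by case/orP: (pm (s^-1%g j)) => /eqP->; case: (b _).
by rewrite mod3M mod3_lift3 -(eqmxP eP) submxMr.
Qed.

Lemma cwordN v : cword v -> cword (- v).
Proof.
move=> /andP[/forallP pm cv]; apply/andP; split.
  by apply/forallP=> j; rewrite mxE orbC; case/orP: (pm j) => /eqP->.
by rewrite /mod3 map_mxN -scaleN1r scalemx_sub.
Qed.

(* A codeword of weight 36 that is not a row of H17, and two automorphisms of
   the code that generate a group transitive on such words up to sign. *)
Definition w0 : seq bool := map (fun n => n == 1%N)
  [:: 0; 0; 1; 0; 1; 1; 0; 1; 1; 0; 1; 0; 1; 1; 1; 1; 1; 1; 0; 0; 0; 0; 1; 0; 1;
   0; 1; 0; 0; 0; 1; 1; 1; 1; 1; 1].
Definition gen1 : seq nat :=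
  [:: 31; 17; 3; 0; 25; 11; 28; 21; 22; 12; 34; 9; 19; 26; 14; 4; 7; 32; 67; 52;
   38; 36; 60; 46; 65; 56; 59; 49; 71; 44; 54; 63; 51; 41; 42; 69].
Definition gen2 : seq nat :=
  [:: 69; 36; 53; 61; 40; 65; 58; 54; 56; 67; 71; 46; 48; 44; 39; 62; 43; 51;
   33; 0; 16; 24; 5; 28; 23; 19; 21; 30; 34; 11; 13; 9; 2; 27; 6; 14].
(* Words are listed up to sign, normalized to begin with +1. *)
Definition snorm (s : seq bool) : seq bool := if head false s then map negb s else s.

Definition addw (W : seq (seq bool)) s := if s \in W then W else rcons W s.

(** Breadth-first closure: [W] is both the list of words found and the queue, [k] the next word to
    expand, [m] the number of expansions left. That no word of weight 36 is missed is checked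
    separately in [nowhere_zero_ok]. *)
Fixpoint orbit_from (m k : nat) (W : seq (seq bool)) : seq (seq bool) :=
  if m is m'.+1 then
    let s := nth w0 W k in
    orbit_from m' k.+1 (addw (addw W (snorm (act gen1 s))) (snorm (act gen2 s)))
  else W.

Definition orbit_words : seq (seq bool) := orbit_from 408 0 [:: w0].
Definition words : seq (seq bool) := orbit_words ++ H17_rows.

(* Locked, for otherwise the discrimination tests of [done] evaluate the list. *)
Fact word_key : unit. Proof. exact: tt. Qed.
Definition word : nat -> seq bool := locked_with word_key (nth [::] words).
Lemma wordE : word = nth [::] words. Proof. exact: unlock. Qed.

Lemma size_UW : size orbit_words = 408%N. Proof. by vm_compute. Qed.
Lemma words_size : all (fun s => size s == 36%N) words. Proof. by vm_compute. Qed.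
Lemma words_incode : all incode words. Proof. by vm_compute. Qed.

Lemma word_all (P : pred (seq bool)) k : all P words -> (k < 444)%N -> P (word k).
Proof.
have -> : 444%N = size words by rewrite size_cat size_UW.
by move=> ok lt_k; rewrite wordE; exact: (nth_size ok lt_k).
Qed.

Lemma nth_catE T (x : T) A B n k : size A = n ->
  ((k < n)%N -> nth x (A ++ B) k = nth x A k) * (nth x (A ++ B) (n + k) = nth x B k).
Proof.
move=> sA; split; first by move=> lt_k; rewrite nth_cat sA lt_k.
by rewrite nth_cat sA ltnNge leq_addr addKn.
Qed.

Lemma word_UW k : (k < 408)%N -> word k = nth [::] orbit_words k.
Proof. rewrite wordE; exact: (nth_catE [::] H17_rows k size_UW).1. Qed.

Lemma word_HW k : word (408 + k) = nth [::] H17_rows k.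
Proof. rewrite wordE; exact: (nth_catE [::] H17_rows k size_UW).2. Qed.

Lemma word_UW_all (P : pred (seq bool)) k : all P orbit_words -> (k < 408)%N -> P (word k).
Proof.
move=> ok lt_k; rewrite (word_UW lt_k); apply: (nth_size ok).
by rewrite size_UW.
Qed.

Lemma size_word k : (k < 444)%N -> size (word k) = 36%N.
Proof. by move=> lt_k; apply/eqP; exact: (word_all words_size lt_k). Qed.

Lemma cword_sgv s : size s = 36%N -> incode s -> cword (sgv 36 s).
Proof.
move=> ss cs; rewrite /cword incodeP // cs andbT; apply/forallP=> j.
by rewrite mxE; case: nth.
Qed.

Definition wd (k : nat) : 'rV[int]_36 := sgv 36 (word k).

Lemma cword_wd k : (k < 444)%N -> cword (wd k).
Proof.
move=> lt_k; apply: cword_sgv; first exact: size_word.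
exact: (word_all words_incode lt_k).
Qed.

(** A word of weight 36 is a signed sum of all rows of (I, U) whose right half has no zero. The
    recursion shares partial sums between sign vectors with a common prefix. *)
Fixpoint nowhere_zero (R : seq (seq trit)) (acc : seq trit) : seq (seq bool) :=
  if R is r :: R' then
    map (cons false) (nowhere_zero R' (taddl acc (map (tmul (Some false)) r))) ++
    map (cons true) (nowhere_zero R' (taddl acc (map (tmul (Some true)) r)))
  else if None \in acc then [::] else [:: [::]].

Lemma nowhere_zero_complete R acc (x : seq bool) : size x = size R ->
  None \notin comb (map Some x) R acc -> x \in nowhere_zero R acc.
Proof.
elim: R acc x => [|r R IHR] acc [|b x] //=; first by move=> _ nacc; rewrite (negPf nacc) mem_head.
move=> [sx] nacc; rewrite mem_cat.
  have := IHR _ _ sx nacc.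
case: b {nacc} => x_en; apply/orP; [right|left]; apply: (map_f (cons _)); exact: x_en.
Qed.

Definition extend_in (W l : seq (seq bool)) : bool := all (fun x => (false :: x) \in W) l.

Lemma extend_inP W l x : extend_in W l -> x \in l -> (false :: x) \in W.
Proof. by move/allP; apply. Qed.

(** The first sign is fixed to +1, leaving 2^17 cases. Comparing left halves is enough, since they
    determine codewords. *)
Lemma nowhere_zero_ok : extend_in [seq take 18 (snorm s) | s <- words]
  (nowhere_zero (behead U_rows) (taddl (nseq 18 None) (head [::] U_rows))).
Proof. by vm_compute. Qed.

Lemma nth_map_mem T (rT : eqType) (x0 : T) (f : T -> rT) (W : seq T) n y : size W = n ->
  y \in map f W -> exists2 k, (k < n)%N & y = f (nth x0 W k).
Proof.
move=> <- /(nthP y)[k]; rewrite size_map => lt_k <-; exists k => //.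
exact: nth_map.
Qed.

Lemma size_words : size words = 444%N. Proof. by rewrite size_cat size_UW. Qed.

Lemma nowhere_zero_word x : x \in nowhere_zero (behead U_rows) (taddl (nseq 18 None) (head [::] U_rows)) ->
  exists2 k, (k < 444)%N & false :: x = take 18 (snorm (word k)).
Proof.
by rewrite wordE => x_en; exact: (nth_map_mem [::] size_words (extend_inP nowhere_zero_ok x_en)).
Qed.

Lemma sgvN n s : size s = n -> sgv n (map negb s) = - sgv n s.
Proof.
move=> ss; apply/rowP=> j; rewrite !mxE (nth_map false) ?ss //.
by rewrite signrN.
Qed.

Lemma sgv_snorm n s : size s = n ->
  exists b : bool, sgv n (snorm s) = (-1) ^+ b *: sgv n s.
Proof.
move=> ss; rewrite /snorm; case: ifP => _; last by exists false; rewrite scale1r.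
by exists true; rewrite sgvN // scaleN1r.
Qed.

Lemma size_snorm s : size (snorm s) = size s.
Proof. by rewrite /snorm; case: ifP; rewrite ?size_map. Qed.

Lemma comb_UT x acc : comb (Some false :: x) U_rows acc =
  comb x (behead U_rows) (taddl acc (head [::] U_rows)).
Proof.
have -> : U_rows = head [::] U_rows :: behead U_rows by vm_compute.
rewrite [LHS]/=; congr comb; congr taddl.
Qed.

Lemma words_completeW v : cword v -> v 0 0 = 1 ->
  exists2 k, (k < 444)%N & exists b : bool, v = (-1) ^+ b *: wd k.
Proof.
move=> /andP[/forallP pm cv] v0.
pose s := [seq v 0 j == -1 | j <- enum 'I_36].
have ss : size s = 36%N by rewrite size_map size_enum_ord.
have vE : v = sgv 36 s.
  apply/rowP=> j; rewrite mxE (nth_map ord0) ?size_enum_ord // nth_ord_enum.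
  by case/orP: (pm j) => /eqP->.
have s0 : head false s = false.
  by rewrite -nth0 (nth_map ord0) ?size_enum_ord // (nth_ord_enum _ ord0) v0.
move: cv; rewrite {}vE incodeP // => /eqP cs.
have [k lt_k eq_t] : exists2 k, (k < 444)%N & take 18 s = take 18 (snorm (word k)).
  have [s' eq_s ss'] : exists2 s', s = false :: s' & size s' = 35%N.
    by case: s ss s0 {cs} => [|b s'] //= [ss] ->; exists s'.
  have eq_t : take 18 s = false :: take 17 s' by rewrite eq_s.
  move: cs; rewrite eq_t map_cons comb_UT => cs.
  apply: nowhere_zero_word; apply: nowhere_zero_complete; first by rewrite size_take ss'.
  by rewrite -cs; apply/mapP=> -[].
exists k => //; have st := size_word lt_k; have cwt := cword_wd lt_k.
have [b eq_b] := sgv_snorm st; exists b; rewrite /wd -eq_b; congr sgv.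
have : cword (sgv 36 (snorm (word k))).
  by rewrite eq_b; case: b {eq_b}; rewrite ?scaleN1r ?scale1r; [exact: cwordN cwt|exact: cwt].
case/andP=> _; rewrite incodeP ?size_snorm // => /eqP ct.
(* Two codewords with the same left half have the same right half. *)
rewrite -[s](cat_take_drop 18) -[snorm _](cat_take_drop 18) eq_t; congr (_ ++ _).
by apply: (inj_map (@Some_inj _)); rewrite cs ct eq_t.
Qed.

Lemma words_complete v : cword v ->
  exists2 k, (k < 444)%N & exists b : bool, v = (-1) ^+ b *: wd k.
Proof.
move=> cv; case/andP: (cv) => /forallP/(_ 0)/orP[] /eqP v0 _.
  exact: words_completeW.
have [|k lt_k [b eq_v]] := words_completeW (cwordN cv); first by rewrite mxE v0.
by exists k => //; exists (~~ b); rewrite signrN scaleNr -eq_v opprK.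
Qed.

(** * Automorphisms of the code *)

Definition maps_rows n (M : 'M[int]_n) (P : 'M['F_3]_n) (B : 'M[int]_n) : Prop :=
  forall i, exists i', exists b : bool, row i M *m lift3 P = (-1) ^+ b *: row i' B.

(** Injectivity: two rows with proportional images would be proportional, yet distinct rows are
    orthogonal and nonzero. *)
Lemma maps_rows_fun n (M B : 'M[int]_n) P :
    hadamard M -> monomial_mx P -> maps_rows M P B ->
  exists2 f : 'I_n -> 'I_n, injective f &
    exists b : 'I_n -> bool, forall i, row i M *m lift3 P = (-1) ^+ b i *: row (f i) B.
Proof.
move=> hM mP mMP; have [f /fin_all_exists[b fP]] := fin_all_exists mMP.
exists f; last by exists b.
move=> i j eq_f; apply/eqP/negPn/negP => ne_ij.
have n_gt0 : (0 < n)%N by apply: leq_ltn_trans (ltn_ord i).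
have ip_ij := hadamard_ip i j hM; rewrite (negPf ne_ij) mulr0n in ip_ij.
have ip_ii := hadamard_ip i i hM; rewrite eqxx mulr1n in ip_ii.
move: ip_ii ip_ij; rewrite -(ip_monomial (row i M) (row j M) mP).
rewrite -(ip_monomial (row i M) (row i M) mP) !fP eq_f !ipZl !ipZr.
move=> ip_ii /eqP; rewrite !mulf_eq0 !signr_eq0 /= => /eqP x0; move: ip_ii.
by rewrite x0 !mulr0 => /eqP; rewrite eq_sym pnatr_eq0 eqn0Ngt n_gt0.
Qed.

Lemma maps_rows_isom n (M B : 'M[int]_n) P :
    hadamard M -> monomial_mx P -> maps_rows M P B ->
  exists L, (L, P) \in hadamard_isom M B.
Proof.
move=> hM mP /(maps_rows_fun hM mP)[f f_inj [b fP]].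
have [|L mL eqL] := @row_monomial _ (M *m lift3 P) B f b f_inj.
  by move=> i; rewrite row_mul fP.
by exists L; rewrite inE /= mL mP -mulmxA eqL eqxx.
Qed.

(** * Transitivity on the 408 words and the separation of the rows of H *)

Lemma gen1_ok : gen_ok gen1. Proof. by vm_compute. Qed.
Lemma gen2_ok : gen_ok gen2. Proof. by vm_compute. Qed.

Definition reached (s : seq bool) : Prop :=
  size s = 36%N /\ exists2 P, P \in code_aut L17 & sgv 36 w0 *m lift3 P = sgv 36 s.

Lemma size_act g s : gen_ok g -> size (act g s) = 36%N.
Proof.
by case/andP=> /perm_size; rewrite size_map size_iota => sg _; rewrite size_map.
Qed.

Lemma code_aut_monomial P : P \in code_aut L17 -> monomial_mx P.
Proof. by case/code_autP. Qed.

Lemma reached_act g s : gen_ok g -> reached s -> reached (snorm (act g s)).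
Proof.
move=> gP [ss [P aP eqP]]; split; first by rewrite size_snorm size_act.
have [b ->] := sgv_snorm (size_act s gP); rewrite -sgv_act; last by case/andP: gP.
have aPg := code_aut_mul aP (gen_okP gP).
exists (if b then - (P *m gmx 36 g) else P *m gmx 36 g).
  by case: b => //; apply: code_aut_opp.
rewrite -eqP -mulmxA -lift3_mul ?code_aut_monomial ?gen_okP //.
by case: b; rewrite ?lift3N ?mulmxN ?scaleN1r ?scale1r.
Qed.

Lemma orbit_from_reached m k W : (forall s, s \in W -> reached s) ->
  forall s, s \in orbit_from m k W -> reached s.
Proof.
elim: m k W => [|m IHm] k W Wr //=.
have w0r : reached w0.
  by split=> //; exists 1%:M; rewrite ?code_aut1 // -{2}[sgv _ _]mulmx1 -(mono1 int)
    -lift3_mono mono1.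
have addr W' s' : (forall s, s \in W' -> reached s) -> reached s' ->
    forall s, s \in addw W' s' -> reached s.
  move=> rW' rs' s; rewrite /addw; case: ifP => _; first exact: rW'.
  by rewrite mem_rcons inE => /predU1P[->|/rW'].
(* Past the end of the queue the default [w0] is returned, which is reached as well. *)
have kr : reached (nth w0 W k).
  have [lt_k|ge_k] := ltnP k (size W); first by apply/Wr/mem_nth.
  by rewrite nth_default.
apply/IHm/addr; first apply: addr => //.
  exact: reached_act gen1_ok kr.
exact: reached_act gen2_ok kr.
Qed.

Lemma wd0 : wd 0 = sgv 36 w0.
Proof. by rewrite /wd word_UW //; congr sgv; vm_compute. Qed.

(** Each listed word was produced by the generators, so it comes with an automorphism; negating that
    automorphism gives the other sign. *)
Lemma UW_trans k (b : bool) : (k < 408)%N ->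
  exists2 P, P \in code_aut L17 & wd 0 *m lift3 P = (-1) ^+ b *: wd k.
Proof.
move=> lt_k; have : reached (word k).
  suff UWr s : s \in orbit_words -> reached s.
    rewrite (word_UW lt_k); apply: UWr; apply: mem_nth.
    by rewrite size_UW.
  apply: (@orbit_from_reached 408 0 [:: w0]) => {}s.
  rewrite inE => /eqP->; split=> //; exists 1%:M; rewrite ?code_aut1 //.
  by rewrite -(mono1 'F_3) lift3_mono mono1 mulmx1.
case=> _ [P aP eqP]; exists (if b then - P else P).
  by case: b => //; apply: code_aut_opp.
by rewrite wd0; case: b; rewrite ?lift3N ?mulmxN eqP ?scaleN1r ?scale1r.
Qed.

Lemma ip_wd i j : (i < 444)%N -> (j < 444)%N ->
  ip (wd i) (wd j) = 36%:Z - (2 * dis (word i) (word j))%:Z.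
Proof. by move=> lt_i lt_j; rewrite ip_sgv // size_word. Qed.

(** Distances 12 and 24 mean inner products 12 and -12. Rows of H never have them with a word of
    weight 36, while each of the 408 words does; this separates the two kinds. *)
Lemma HW_dis_ok :
  all (fun h => all (fun s => dis h s \notin [:: 12; 24]%N) words) H17_rows.
Proof. by vm_compute. Qed.

Lemma row_H17 (i : 'I_36) : row i H17 = wd (408 + i).
Proof.
by rewrite H17E row_bmx /wd word_HW.
Qed.

Lemma H17_ip (i : 'I_36) u : cword u -> ip (row i H17) u != 12.
Proof.
case/words_complete=> k lt_k [b ->]; rewrite row_H17 ipZr ip_wd //; last first.
  by rewrite -[444%N]/(408 + 36)%N ltn_add2l.
have lt_i : (i < size H17_rows)%N by rewrite size_mkseq.
have ok := nth_size HW_dis_ok lt_i; have := word_all ok lt_k; rewrite -word_HW {ok}.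
move: (dis _ _) => d; rewrite !inE negb_or => /andP[/eqP d12 /eqP d24].
by apply/eqP; case: b; rewrite ?mulN1r ?mul1r; lia.
Qed.

(** Words 0 and 1 are at distance 12, and transitivity carries this pair along. *)
Lemma UW_ip k : (k < 408)%N -> exists2 u, cword u & ip (wd k) u = 12.
Proof.
move=> lt_k; have [P aP] := UW_trans false lt_k; rewrite scale1r => <-.
have [j lt_j ip12] : exists2 j, (j < 444)%N & ip (wd 0) (wd j) = 12.
  exists 1%N; first exact: isT.
  rewrite ip_wd; [|exact: isT..].
  have -> : dis (word 0) (word 1) = 12%N; last by [].
  by rewrite wordE; vm_compute.
exists (wd j *m lift3 P); first by apply: cword_aut aP _; apply: cword_wd.
by rewrite ip_monomial //; apply: code_aut_monomial.
Qed.

Lemma H17_row_of u : cword u -> (forall v, cword v -> ip u v != 12) ->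
  exists i, exists b : bool, u = (-1) ^+ b *: row i H17.
Proof.
move=> cu nu; have [k lt_k [b eq_u]] := words_complete cu.
have [lt_k8|ge_k8] := ltnP k 408; last first.
  have lt_i : (k - 408 < 36)%N by rewrite ltn_subLR.
  by exists (Ordinal lt_i), b; rewrite eq_u row_H17 /= subnKC.
have [v cv ip12] := UW_ip lt_k8.
have /eqP[] : ip u ((-1) ^+ b *: v) != 12.
  by apply: nu; case: (b); rewrite ?scaleN1r ?scale1r //; apply: cwordN.
rewrite eq_u ipZl ipZr ip12 mulrA -signr_addb addbb mul1r.
done.
Qed.

Lemma code_aut_tr_cancel P (u : 'rV[int]_36) : P \in code_aut L17 ->
  u *m lift3 P^T *m lift3 P = u.
Proof.
move=> /code_aut_monomial mP; rewrite -mulmxA lift3_tr mulmx1C ?mulmx1 //.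
exact: lift3_mulT.
Qed.

Lemma cword_H17 i : cword (row i H17).
Proof. by rewrite row_H17; apply: cword_wd; rewrite -[444%N]/(408 + 36)%N ltn_add2l. Qed.

(* Among the weight 36 codewords the rows of H17 are those having inner
   product 12 with no other one, so code automorphisms permute them. *)
Lemma code_aut_H17 P : P \in code_aut L17 -> maps_rows H17 P H17.
Proof.
move=> aP i; apply: H17_row_of; first exact/cword_aut/cword_H17.
move=> v cv; rewrite -(code_aut_tr_cancel v aP) ip_monomial ?code_aut_monomial //.
by apply/H17_ip/cword_aut; first exact: code_aut_tr.
Qed.

Lemma hadamard_H17 : hadamard H17. Proof. by rewrite H17E had_okP // HW_ok. Qed.

(** The left factor does not change row spaces, so R maps the span of H, which is the whole code,
    into the code. *)
Lemma isom_code_aut M R L : (mod3 M <= L17)%MS -> (L, R) \in hadamard_isom H17 M ->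
  R \in code_aut L17.
Proof.
move=> eM; rewrite inE /= => /and3P[mL mR /eqP eqH]; apply: code_aut_sub => //.
have -> : mod3 H17 *m R = L^T *m mod3 M.
  by rewrite -eqH !mod3M !mod3_lift3 !mulmxA monomial_Tmul // mul1mx.
exact: submx_trans (submxMl _ _) eM.
Qed.

Lemma hadamard_aut_H17 : [set LR.2 | LR in hadamard_aut H17] = code_aut L17.
Proof.
apply/setP=> R; apply/imsetP/idP => [[[L R'] /= aLR ->]|aR].
  by apply: isom_code_aut aLR; case/andP: mod3_H17.
have [L aLR] := maps_rows_isom hadamard_H17 (code_aut_monomial aR) (code_aut_H17 aR).
by exists (L, R).
Qed.

(** M M^T = n I makes M cancellable, so R determines L: the automorphism group acts faithfully on
    coordinates and can be compared with that of the code. *)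
Lemma hadamard_aut_inj n (M : 'M[int]_n) : hadamard M ->
  {in hadamard_aut M &, injective (fun LR => LR.2)}.
Proof.
move=> /andP[_ /eqP hM] [L R] [L' R'] + + /= eqR; rewrite -{}eqR !inE /=.
move=> /and3P[_ mR /eqP eqL] /and3P[_ _ /eqP eqL']; congr (_, _).
case: n => [|n] in M hM L R L' R' mR eqL eqL' *; first by rewrite [L]flatmx0 [L']flatmx0.
apply: lift3_inj; have := congr1 (fun X => X *m (lift3 R)^T *m M^T) (etrans eqL (esym eqL')).
rewrite /= -!(mulmxA _ (lift3 R)) lift3_mulT // !mulmx1 -!mulmxA hM !mul_mx_scalar.
move/eqP; rewrite -subr_eq0 -scalerBr scalemx_eq0 pnatr_eq0 /= subr_eq0.
by move/eqP.
Qed.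

(** * Bound propagation for linear equations in 0/1 unknowns *)

(* A linear equation sum p_u x_u + tm = sum m_u x_u + tp in 0/1 unknowns x_u is
   given by its list of coefficients (p_u, m_u) and by its constants tp, tm. *)
Definition coefs := seq (nat * nat).

Fixpoint lsum (cs : coefs) (x : seq bool) : nat * nat :=
  match cs, x with
  | c :: cs', b :: x' =>
      let r := lsum cs' x' in if b then (c.1 + r.1, c.2 + r.2)%N else r
  | _, _ => (0, 0)%N
  end.

Definition status := seq (option bool).

Fixpoint known (cs : coefs) (s : status) : nat * nat :=
  match cs, s with
  | c :: cs', b :: s' =>
      let r := known cs' s' in
      if b is Some true then (c.1 + r.1, c.2 + r.2)%N else r
  | _, _ => (0, 0)%N
  end.

Fixpoint unknown (cs : coefs) (s : status) : nat * nat :=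
  match cs, s with
  | c :: cs', b :: s' =>
      let r := unknown cs' s' in
      if b is None then (c.1 + r.1, c.2 + r.2)%N else r
  | _, _ => (0, 0)%N
  end.

(* For b = true the unknown positive terms must all be present and the unknown
   negative ones absent; for b = false it is the other way round. *)
Fixpoint extremal (b : bool) (cs : coefs) (s : status) : status :=
  match cs, s with
  | c :: cs', None :: s' =>
      (if (0 < c.1)%N then Some b else if (0 < c.2)%N then Some (~~ b) else None)
        :: extremal b cs' s'
  | _ :: cs', a :: s' => a :: extremal b cs' s'
  | _, _ => s
  end.

(** The two sides of the equation range over the intervals [k.1 + tm, k.1 + u.1 + tm] and
    [k.2 + tp, k.2 + u.2 + tp]. Disjoint intervals refute it; intervals that only touch force every
    unknown with a nonzero coefficient. *)
Definition deduce (cs : coefs) (tp tm : nat) (s : status) : option status :=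
  let k := known cs s in let u := unknown cs s in
  if (k.1 + u.1 + tm < k.2 + tp)%N || (k.2 + u.2 + tp < k.1 + tm)%N then None
  else if (k.1 + u.1 + tm == k.2 + tp)%N then Some (extremal true cs s)
  else if (k.2 + u.2 + tp == k.1 + tm)%N then Some (extremal false cs s)
  else Some s.

Fixpoint agree (s : status) (x : seq bool) : bool :=
  match s, x with
  | a :: s', b :: x' => (if a is Some c then c == b else true) && agree s' x'
  | [::], [::] => true
  | _, _ => false
  end.

Lemma lsum_bounds cs s x : agree s x ->
  let k := known cs s in let u := unknown cs s in let l := lsum cs x in
  [/\ (k.1 <= l.1 <= k.1 + u.1)%N, (k.2 <= l.2 <= k.2 + u.2)%N,
      (l.1 = k.1 + u.1)%N -> l.2 = k.2 -> agree (extremal true cs s) x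
    & l.1 = k.1 -> (l.2 = k.2 + u.2)%N -> agree (extremal false cs s) x].
Proof.
elim: cs s x => [|[p m] cs IH] [|a s] [|b x] //= /andP[ab /IH[]].
move: (known cs s) (unknown cs s) (lsum cs x) => [k1 k2] [u1 u2] [l1 l2] /=.
move=> b1 b2 ext1 ext2; case: a ab => [c /eqP->|_] /=.
  case: b => /=; rewrite ?eqxx /=; split; try lia; move=> e1 e2;
    solve [apply: ext1; lia | apply: ext2; lia].
case: b => /=; split; try lia; move=> e1 e2.
- have -> : agree (extremal true cs s) x by apply: ext1; lia.
  by case: ltnP => // p0; case: ltnP => // m0; lia.
- have -> : agree (extremal false cs s) x by apply: ext2; lia.
  by case: ltnP => // p0; [lia|case: ltnP].
- have -> : agree (extremal true cs s) x by apply: ext1; lia.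
  by case: ltnP => // p0; [lia|case: ltnP].
- have -> : agree (extremal false cs s) x by apply: ext2; lia.
  by case: ltnP => // p0; case: ltnP => // m0; lia.
Qed.

Lemma deduceP cs tp tm s x : agree s x ->
    ((lsum cs x).1 + tm = (lsum cs x).2 + tp)%N ->
  if deduce cs tp tm s is Some s' then agree s' x else false.
Proof.
move=> sx; case: (lsum_bounds cs sx); rewrite /deduce.
move: (known cs s) (unknown cs s) (lsum cs x) => [k1 k2] [u1 u2] [l1 l2] /=.
move=> b1 b2 ext1 ext2 eql; case: ifP => [|_]; first lia.
case: ifP => [/eqP e|_]; first by apply: ext1; lia.
by case: ifP => [/eqP e|_ //]; apply: ext2; lia.
Qed.

(** Every node first propagates along its list of equations. Then [Fail] claims a contradiction,
    [Done] that the words not yet excluded lie in one given frame, and [Br] splits on an unknown,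
    the case where it is present coming first. *)
Inductive cert :=
| Fail of seq N
| Done of seq N & N
| Br of seq N & N & cert & cert.

Section Check.

Variables (eqn : nat -> nat -> coefs * (nat * nat)) (goals : seq (seq N)).

(* [us] lists the pairs (v, w) of the equations to be used, in this order. *)
Fixpoint run (us : seq N) (s : status) : option status :=
  match us with
  | v :: w :: us' =>
      let e := eqn (nat_of_bin v) (nat_of_bin w) in
      if deduce e.1 e.2.1 e.2.2 s is Some s' then run us' s' else None
  | _ => Some s
  end.

(** Containment suffices, because the rows of a Hadamard matrix are later matched injectively with
    the 36 rows of H'. *)
Definition inside (s : status) (ix : seq nat) : bool :=
  all (fun u => (nth None s u == Some false) || (u \in ix)) (iota 0 (size s)).

Fixpoint check (c : cert) (s : status) : bool :=
  match c with
  | Fail us => if run us s is None then true else false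
  | Done us k => if run us s is Some s'
                 then inside s' (map nat_of_bin (nth [::] goals (nat_of_bin k))) else true
  | Br us u c1 c0 => if run us s is Some s'
                     then (nat_of_bin u < size s')%N &&
                          check c1 (set_nth None s' (nat_of_bin u) (Some true)) &&
                          check c0 (set_nth None s' (nat_of_bin u) (Some false))
                     else true
  end.

Variable x : seq bool.
Hypothesis eqn_x : forall v w, let e := eqn v w in
  ((lsum e.1 x).1 + e.2.2 = (lsum e.1 x).2 + e.2.1)%N.

Lemma runP us s : agree s x -> if run us s is Some s' then agree s' x else false.
Proof.
(* The list is consumed two entries at a time, so the induction is on a bound for its length. *)
have [n le_n] := ubnP (size us); elim: n us s le_n => // n IHn [|v [|w us]] s //= le_n sx.
have := deduceP sx (eqn_x (nat_of_bin v) (nat_of_bin w)).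
by case: deduce => // s' s'x; apply: IHn => //; apply: ltnW.
Qed.

Lemma agree_size s y : agree s y -> size s = size y.
Proof. by elim: s y => [|a s IHs] [|b y] //= /andP[_ /IHs->]. Qed.

Lemma agree_nth s y u : agree s y -> (nth None s u == Some false) -> nth false y u = false.
Proof.
elim: s y u => [|a s IHs] [|b y] [|u] //= /andP[ab /IHs sy] //; last exact: sy.
by case: a ab => // c /eqP-> /eqP[].
Qed.

Lemma agree_set s y u : agree s y -> (u < size y)%N ->
  agree (set_nth None s u (Some (nth false y u))) y.
Proof.
elim: s y u => [|a s IHs] [|b y] [|u] //= /andP[ab sy] lt_u; rewrite ?eqxx ?sy //.
by rewrite ab; apply: IHs.
Qed.

Lemma checkP c s : agree s x -> check c s ->
  exists k, forall u, nth false x u -> u \in map nat_of_bin (nth [::] goals k).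
Proof.
elim: c s => [us|us k|us u c1 IH1 c0 IH0] s sx /=; have := runP us sx;
  case: run => // s' s'x.
  move=> /allP in_k; exists (nat_of_bin k) => u xu.
  have lt_u : (u < size s')%N.
    by rewrite (agree_size s'x) ltnNge; apply: contraL xu => /(nth_default false)->.
  have := in_k u; rewrite mem_iota lt_u => /(_ isT)/orP[|//].
  by move/(agree_nth s'x); rewrite xu.
rewrite -andbA => /and3P[]; rewrite (agree_size s'x) => /(agree_set s'x).
by case: nth => [su /(IH1 _ su)|su _ /(IH0 _ su)].
Qed.

End Check.

(** * The frames through a word *)

(* The inner product of two of the 408 words is 12(p - m). *)
Definition gcoef (d : nat) : nat * nat :=
  match d with 0 => (3, 0) | 12 => (1, 0) | 24 => (0, 1) | 36 => (0, 3) | _ => (0, 0) end%N.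

Definition gmul (a b : nat * nat) : nat * nat :=
  (a.1 * b.1 + a.2 * b.2, a.1 * b.2 + a.2 * b.1)%N.

Definition gram_of (W : seq (seq bool)) : seq coefs :=
  [seq [seq gcoef (dis s t) | t <- W] | s <- W].

Fixpoint gmuls (a b : coefs) : coefs :=
  match a, b with
  | x :: a', y :: b' => gmul x y :: gmuls a' b'
  | _, _ => [::]
  end.

(** With inner products 12 g, Parseval's identity reads 144 sum_u x_u g(v,u) g(w,u) = 432 g(v,w),
    whence the factor 3. Positive and negative parts are kept apart to compute in nat. *)
Definition parseval_eqn (G : seq coefs) (v w : nat) : coefs * (nat * nat) :=
  let gv := nth [::] G v in let gw := nth [::] G w in
  let t := nth (0, 0)%N gv w in (gmuls gv gw, (3 * t.1, 3 * t.2)%N).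

(* The 24 Hadamard matrices through the first word, each as the list of the
   indices of its rows, and a certificate, found by computer, that there are no
   others. *)
Definition frames0 : seq (seq N) :=
  [:: [:: 0; 14; 18; 27; 32; 35; 40; 41; 45; 76; 79; 114; 124; 126; 140; 147; 153;
   164; 165; 171; 184; 216; 231; 249; 251; 255; 259; 263; 270; 276; 297; 301;
   323; 360; 379; 404];
     [:: 0; 10; 32; 35; 41; 46; 54; 76; 79; 112; 114; 117; 126; 140; 153; 165; 177;
   184; 192; 199; 209; 231; 232; 249; 251; 259; 276; 298; 305; 323; 353; 370;
   379; 391; 395; 404];
     [:: 0; 14; 18; 27; 40; 41; 44; 47; 108; 114; 121; 123; 124; 128; 147; 165;
   171; 179; 216; 231; 243; 254; 255; 263; 270; 276; 279; 300; 307; 320; 323;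
   344; 360; 375; 388; 404];
     [:: 0; 14; 39; 40; 47; 58; 61; 96; 104; 107; 108; 121; 123; 124; 165; 216;
   227; 231; 254; 255; 269; 270; 276; 292; 307; 308; 319; 320; 323; 333; 336;
   373; 381; 388; 398; 404];
     [:: 0; 7; 18; 33; 35; 40; 41; 46; 76; 77; 91; 114; 127; 140; 147; 153; 154;
   160; 165; 177; 184; 189; 231; 251; 259; 264; 270; 276; 278; 298; 304; 323;
   379; 384; 395; 404];
     [:: 0; 7; 14; 18; 40; 41; 60; 61; 67; 76; 77; 89; 107; 108; 114; 123; 124;
   140; 147; 153; 154; 165; 216; 231; 254; 255; 259; 264; 270; 276; 319; 320;
   323; 343; 381; 404];
     [:: 0; 10; 12; 33; 35; 41; 46; 56; 72; 91; 114; 117; 127; 149; 153; 165; 177;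
   184; 192; 224; 234; 251; 259; 268; 276; 278; 281; 298; 348; 354; 358; 379;
   391; 395; 401; 404];
     [:: 0; 10; 19; 23; 41; 46; 54; 56; 106; 114; 117; 149; 153; 159; 165; 177;
   184; 192; 198; 209; 224; 237; 259; 281; 286; 290; 298; 305; 329; 352; 353;
   357; 369; 379; 391; 395];
     [:: 0; 27; 41; 54; 87; 111; 114; 117; 118; 124; 128; 135; 136; 137; 142; 161;
   165; 171; 179; 188; 192; 198; 216; 237; 240; 256; 257; 279; 286; 302; 305;
   342; 352; 375; 385; 393];
     [:: 0; 6; 19; 36; 41; 46; 54; 85; 87; 106; 114; 117; 128; 135; 159; 161; 165;
   172; 192; 198; 205; 209; 237; 252; 256; 279; 286; 295; 298; 302; 305; 311;
   342; 352; 353; 357];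
     [:: 0; 10; 41; 46; 54; 111; 112; 114; 117; 128; 161; 165; 176; 177; 179; 188;
   191; 192; 198; 199; 209; 232; 237; 279; 286; 298; 302; 305; 352; 353; 370;
   375; 391; 394; 395; 397];
     [:: 0; 14; 18; 27; 40; 41; 45; 111; 114; 124; 128; 147; 161; 164; 165; 171;
   176; 179; 188; 191; 198; 216; 237; 255; 263; 270; 279; 286; 297; 301; 302;
   352; 360; 375; 394; 397];
     [:: 0; 16; 61; 65; 68; 71; 96; 104; 107; 124; 142; 145; 148; 165; 169; 200;
   203; 216; 223; 227; 240; 254; 260; 268; 276; 308; 319; 320; 333; 336; 345;
   354; 373; 381; 398; 404];
     [:: 0; 6; 19; 28; 36; 46; 65; 75; 80; 82; 85; 96; 104; 106; 156; 159; 165;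
   172; 190; 198; 205; 209; 252; 271; 286; 295; 298; 311; 325; 336; 345; 351;
   353; 357; 363; 373];
     [:: 0; 27; 28; 65; 75; 80; 82; 96; 104; 111; 118; 124; 136; 137; 142; 156;
   165; 171; 179; 188; 190; 198; 216; 240; 257; 271; 286; 325; 336; 345; 351;
   363; 373; 375; 385; 393];
     [:: 0; 3; 16; 38; 65; 68; 75; 82; 85; 96; 104; 106; 124; 132; 142; 145; 156;
   165; 169; 198; 205; 216; 240; 271; 286; 308; 319; 325; 336; 345; 351; 357;
   373; 380; 381; 398];
     [:: 0; 39; 58; 61; 65; 75; 86; 96; 104; 107; 111; 118; 124; 142; 165; 188;
   198; 206; 216; 227; 230; 240; 257; 269; 286; 292; 308; 319; 322; 333; 336;
   345; 351; 373; 381; 398];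
     [:: 0; 18; 27; 41; 44; 65; 75; 86; 111; 114; 118; 124; 128; 142; 147; 165;
   171; 179; 188; 198; 206; 216; 230; 240; 243; 257; 263; 279; 286; 300; 322;
   344; 345; 351; 360; 375];
     [:: 0; 12; 25; 33; 35; 46; 50; 72; 85; 91; 96; 127; 129; 165; 172; 205; 234;
   235; 251; 268; 271; 276; 278; 295; 296; 298; 318; 325; 331; 336; 348; 354;
   358; 389; 401; 404];
     [:: 0; 25; 33; 35; 46; 71; 91; 96; 98; 127; 134; 160; 165; 175; 177; 184; 189;
   203; 225; 227; 251; 268; 276; 278; 298; 304; 331; 333; 336; 354; 358; 379;
   384; 395; 401; 404];
     [:: 0; 19; 23; 25; 46; 50; 54; 85; 96; 106; 129; 159; 165; 172; 198; 205; 209;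
   235; 237; 271; 286; 290; 295; 296; 298; 305; 318; 325; 329; 331; 336; 352;
   353; 357; 369; 389];
     [:: 0; 14; 25; 60; 61; 67; 71; 89; 96; 98; 107; 108; 123; 124; 134; 165; 175;
   203; 216; 225; 227; 254; 255; 268; 276; 319; 320; 331; 333; 336; 343; 354;
   358; 381; 401; 404];
     [:: 0; 3; 20; 25; 33; 38; 46; 59; 75; 82; 85; 91; 96; 106; 132; 152; 156; 165;
   172; 198; 205; 271; 275; 286; 295; 296; 298; 318; 325; 331; 336; 351; 357;
   358; 380; 401];
     [:: 0; 20; 25; 33; 46; 59; 61; 71; 91; 96; 107; 148; 152; 165; 172; 200; 203;
   223; 227; 254; 260; 268; 275; 276; 295; 296; 298; 318; 320; 331; 333; 336;
   354; 358; 401; 404]]%num.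
Definition search_tree : cert :=
 (Br [::
  0; 0; 85; 40; 88; 48; 46; 5; 64; 46; 48; 26; 48; 17; 64; 60; 64; 54; 41;
  4; 70; 46; 70; 54; 74; 54; 74; 40; 74; 34; 165; 165] 36
 (Br [::
  36; 36; 32; 21; 32; 24; 33; 21; 42; 18; 21; 2; 38; 21; 42; 24; 45; 24;
  47; 21; 47; 30; 52; 27; 62; 18; 63; 2; 252; 252; 24; 16; 17; 7; 27; 17;
  27; 19; 15; 8; 28; 1; 33; 27; 41; 19; 13; 9; 9; 3; 58; 42; 62; 46; 65;
  41; 67; 12; 68; 9; 73; 19; 18; 9; 74; 20; 35; 24; 92; 46; 102; 5; 286;
  286; 3; 2; 6; 2; 11; 7; 14; 6; 20; 9; 24; 9; 27; 9; 30; 2; 32; 18; 32;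
  20; 32; 30; 45; 3; 47; 16; 16; 13; 31; 23; 55; 35; 63; 53; 72; 2; 198;
  198; 47; 31; 357; 357; 2; 1; 311; 311; 2; 2; 49; 49; 46; 46; 106; 106; 1;
  1; 6; 6; 27; 27; 85; 85; 19; 19; 31; 31] 54
 (Done [::
  54; 54; 11; 11; 305; 305; 3; 3; 117; 117; 4; 4; 87; 87; 5; 5; 7; 7; 8; 8;
  9; 9; 10; 10] 9)
 (Done [::
  54; 54; 75; 75; 80; 80; 156; 156; 190; 190; 3; 3; 4; 4; 5; 5; 7; 7; 8; 8;
  15; 15] 13))
 (Br [::
  142; 92] 136
 (Br [::
  136; 136; 15; 8; 24; 8; 24; 9; 30; 8; 30; 9; 33; 21; 33; 30; 39; 30; 42;
  18; 44; 20; 45; 21; 52; 27; 53; 27; 3; 2; 24; 11; 38; 15; 15; 11; 393;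
  393; 83; 49; 51; 35; 13; 4; 22; 10; 29; 1; 83; 35; 91; 2; 99; 71; 85; 41;
  98; 68; 21; 2; 63; 9; 111; 49; 31; 26; 65; 49; 49; 33; 99; 14; 98; 63;
  12; 5; 17; 10; 29; 21; 27; 19; 12; 4; 32; 21; 93; 33; 27; 17; 17; 7; 33;
  27; 44; 6; 86; 85; 385; 385; 16; 1; 137; 137; 2; 1; 198; 198; 31; 31; 27;
  27; 111; 111; 124; 124; 171; 171; 1; 1; 2; 2; 142; 142; 19; 19; 216; 216;
  6; 6] 54
 (Done [::
  54; 54; 11; 11; 305; 305; 3; 3; 117; 117; 4; 4; 87; 87; 5; 5; 7; 7; 8; 8;
  9; 9; 10; 10] 8)
 (Done [::
  54; 54; 75; 75; 80; 80; 156; 156; 190; 190; 3; 3; 4; 4; 5; 5; 7; 7; 8; 8;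
  15; 15] 14))
 (Br [::
  144; 106] 186
 (Fail [::
  186; 186; 39; 30; 47; 25; 53; 27; 386; 386; 137; 40; 39; 18; 180; 155;
  11; 7; 38; 5; 5; 3; 8; 3; 94; 34; 336; 336; 20; 9; 26; 18; 18; 9; 133;
  133; 25; 25])
 (Br [::
  262; 177] 198
 (Br [::
  198; 198; 2; 1; 15; 8; 24; 9; 32; 30; 35; 15; 43; 16; 16; 1; 50; 20; 39;
  20; 57; 6; 47; 27; 53; 25; 20; 9; 57; 3; 56; 20; 57; 27; 32; 20; 3; 2;
  66; 35; 68; 2; 68; 57; 73; 35; 72; 39; 83; 9; 83; 52; 32; 18; 75; 53; 86;
  1; 73; 32; 102; 44; 102; 56; 109; 35; 116; 35; 286; 286; 102; 5; 33; 21;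
  66; 59; 182; 31; 31; 23; 31; 28; 246; 1; 33; 30; 247; 2; 71; 37; 76; 34] 188
 (Br [::
  188; 188; 7; 5; 13; 4; 16; 10; 16; 12; 19; 7; 28; 10; 28; 13; 16; 13;
  111; 111; 55; 35; 32; 24; 86; 85; 17; 7; 100; 9; 63; 9; 103; 24; 8; 6;
  24; 11; 143; 52; 12; 4; 127; 94; 25; 11; 44; 6; 150; 47; 38; 20; 166; 66;
  46; 23; 186; 30; 23; 10; 58; 22; 89; 65; 21; 14; 219; 211; 35; 18; 129;
  128; 38; 5; 5; 3; 8; 3] 58
 (Done [::
  58; 58; 41; 41; 39; 39; 104; 104; 227; 227; 269; 269; 308; 308; 333; 333;
  1; 1; 118; 118; 319; 319; 6; 6; 240; 240; 2; 2; 206; 206; 3; 3; 4; 4; 5;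
  5; 7; 7] 16)
 (Br [::
  13; 9; 179; 179; 9; 3; 375; 375; 41; 30; 347; 347; 41; 41; 128; 128; 9; 9] 257
 (Done [::
  257; 257; 191; 191; 44; 44; 118; 118; 142; 142; 230; 230; 300; 300; 344;
  344; 1; 1; 124; 124; 2; 2; 3; 3; 4; 4; 5; 5; 6; 6; 7; 7; 8; 8] 17)
 (Br [::
  24; 14; 24; 16; 394; 394; 76; 76; 191; 191; 237; 237; 32; 32; 35; 35] 147
 (Done [::
  147; 147; 2; 2; 45; 45; 5; 5; 18; 18; 4; 4; 216; 216; 1; 1; 3; 3; 6; 6;
  8; 8] 11)
 (Done [::
  147; 147; 10; 10; 54; 54; 192; 192; 232; 232; 1; 1; 3; 3; 4; 4] 10))))
 (Br [::
  31; 19; 47; 31; 357; 357; 12; 5; 13; 9; 16; 12; 22; 10; 34; 22; 36; 17;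
  40; 22; 29; 21; 35; 30; 43; 22; 46; 22; 58; 3; 5; 3; 8; 3; 34; 5; 58; 17;
  64; 1; 64; 31; 106; 106; 93; 63; 24; 8; 99; 71; 71; 60; 110; 83; 32; 15;
  142; 22; 38; 21; 54; 3; 29; 10; 108; 73; 62; 18; 143; 15; 23; 10; 150;
  131; 112; 8; 173; 158; 14; 3; 63; 44; 182; 5; 21; 14] 132
 (Br [::
  132; 132; 11; 3; 15; 9; 18; 8; 21; 2; 6; 2; 380; 380; 26; 18; 34; 26; 55;
  35; 32; 24; 268; 268; 3; 3; 82; 82; 21; 21; 85; 85; 205; 205; 38; 38; 61;
  61; 71; 71] 145
 (Done [::
  145; 145; 7; 7; 308; 308; 1; 1; 319; 319; 2; 2; 142; 142; 4; 4; 5; 5; 9;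
  9; 11; 11; 13; 13; 17; 17] 15)
 (Done [::
  145; 145; 25; 25; 33; 33; 46; 46; 1; 1; 2; 2; 4; 4; 6; 6] 22))
 (Br [::
  62; 27; 27; 19; 12; 4; 43; 17; 53; 43; 53; 6; 72; 61; 159; 159; 8; 6; 11;
  3; 19; 19; 14; 10; 15; 14; 49; 33; 353; 353; 49; 49; 46; 46; 102; 102;
  12; 8; 54; 54; 4; 4; 23; 23; 11; 11; 12; 12; 33; 33] 25
 (Done [::
  25; 25; 5; 5; 96; 96; 2; 2; 50; 50; 7; 7; 129; 129; 1; 1; 3; 3; 6; 6; 8;
  8; 10; 10; 15; 15] 20)
 (Done [::
  25; 25; 10; 10; 41; 41; 114; 114; 224; 224; 1; 1; 2; 2; 6; 6; 7; 7] 7))))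
 (Br [::] 321
 (Fail [::
  321; 321; 5; 3; 18; 8; 27; 9; 15; 9; 30; 9; 382; 382; 9; 3; 33; 21; 54;
  3; 57; 41; 58; 42; 56; 36])
 (Br [::
  2; 1; 404; 404; 21; 8; 33; 21; 33; 24; 43; 16; 16; 1; 45; 24; 52; 21; 62;
  18; 62; 25; 63; 50; 66; 38; 68; 2; 21; 14; 63; 2; 276; 276; 182; 5; 48;
  5; 60; 5; 246; 31; 15; 8; 32; 24; 247; 102; 68; 62; 102; 47] 231
 (Br [::
  231; 231; 10; 4; 17; 7; 23; 10; 31; 17; 16; 10; 7; 5; 34; 19; 12; 4; 323;
  323; 100; 9; 63; 9; 103; 75; 72; 39; 118; 94; 36; 29; 130; 55; 20; 9; 39;
  21; 174; 120; 72; 50; 183; 143; 36; 28; 109; 82; 32; 18; 38; 20; 198; 11;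
  43; 29] 96
 (Done [::
  96; 96; 114; 114; 39; 39; 104; 104; 227; 227; 292; 292; 333; 333; 2; 2;
  121; 121; 1; 1; 61; 61; 254; 254; 3; 3; 4; 4; 7; 7; 8; 8; 10; 10; 15; 15] 3)
 (Br [::
  56; 21; 41; 24; 37; 29; 41; 30; 22; 10; 73; 70; 114; 114; 18; 9; 25; 9;
  41; 41] 147
 (Br [::
  147; 147; 5; 5; 18; 18; 40; 40] 251
 (Br [::
  251; 251; 303; 303; 76; 76; 140; 140; 184; 184; 9; 9; 24; 24; 70; 70] 126
 (Done [::
  126; 126; 7; 7; 27; 27; 32; 32; 45; 45; 1; 1; 3; 3; 4; 4; 8; 8; 15; 15] 0)
 (Done [::
  126; 126; 7; 7; 33; 33; 91; 91; 154; 154; 1; 1; 2; 2; 4; 4] 4))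
 (Br [::
  26; 21; 254; 254; 306; 306; 108; 108; 123; 123; 124; 124; 4; 4; 51; 51] 107
 (Done [::
  107; 107; 17; 17; 67; 67; 319; 319; 1; 1; 3; 3; 7; 7; 2; 2; 6; 6; 8; 8;
  9; 9; 13; 13] 5)
 (Done [::
  107; 107; 27; 27; 44; 44; 128; 128; 243; 243; 1; 1; 2; 2; 3; 3; 7; 7] 2)))
 (Done [::
  147; 147; 10; 10; 54; 54; 192; 192; 232; 232; 305; 305; 353; 353; 2; 2;
  32; 32; 4; 4; 112; 112; 8; 8; 9; 9; 76; 76; 184; 184; 1; 1; 3; 3; 7; 7;
  15; 15] 1)))
 (Br [::
  5; 3; 268; 268; 13; 5; 12; 5; 16; 12; 23; 10; 26; 13; 29; 7; 38; 5; 354;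
  354; 13; 9; 9; 3; 73; 19; 36; 17; 53; 37; 53; 25; 68; 53; 93; 63; 71; 60;
  110; 83; 59; 21; 150; 131; 112; 8; 208; 155; 43; 22; 161; 99; 27; 9; 288;
  22; 38; 30] 145
 (Done [::
  145; 145; 358; 358; 68; 68; 104; 104; 142; 142; 169; 169; 240; 240; 308;
  308; 5; 5; 16; 16; 65; 65; 2; 2; 148; 148; 1; 1; 61; 61; 3; 3; 4; 4; 7;
  7; 9; 9; 12; 12] 12)
 (Br [::
  8; 6; 11; 7; 358; 358; 15; 11; 401; 401] 89
 (Done [::
  89; 89; 46; 46; 14; 14; 60; 60; 123; 123; 255; 255; 319; 319; 1; 1; 254;
  254; 7; 7; 25; 25; 203; 203; 227; 227; 2; 2; 3; 3; 4; 4; 5; 5; 12; 12;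
  15; 15; 17; 17] 21)
 (Br [::
  23; 15; 91; 91; 185; 185; 33; 33; 11; 11] 25
 (Br [::
  25; 25; 5; 5; 96; 96; 24; 24] 251
 (Br [::
  251; 251; 23; 23; 35; 35; 37; 37] 227
 (Done [::
  227; 227; 3; 3; 71; 71; 304; 304; 1; 1; 177; 177; 2; 2; 4; 4; 6; 6; 10;
  10; 12; 12] 19)
 (Done [::
  227; 227; 12; 12; 72; 72; 85; 85; 129; 129; 1; 1; 2; 2; 4; 4; 6; 6; 8; 8;
  10; 10] 18))
 (Done [::
  251; 251; 20; 20; 61; 61; 107; 107; 152; 152; 1; 1; 2; 2; 3; 3; 6; 6; 10;
  10] 23))
 (Done [::
  25; 25; 10; 10; 41; 41; 114; 114; 117; 117; 224; 224; 259; 259; 3; 3; 12;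
  12; 2; 2; 4; 4; 278; 278; 1; 1; 6; 6; 7; 7; 14; 14] 6))))))))))%num.
Definition start : status := Some true :: nseq 407 None.

Lemma search_ok : check (parseval_eqn (gram_of orbit_words)) frames0 search_tree start.
Proof. by vm_compute. Qed.

Lemma w0_UW_ok : all (fun s => dis w0 s \in [:: 0; 12; 18; 24; 36]%N) orbit_words.
Proof. by vm_compute. Qed.

Lemma w0_HW_ok : all (fun s => dis w0 s \in [:: 15; 21]%N) H17_rows.
Proof. by vm_compute. Qed.

Lemma word0 : word 0 = w0. Proof. by rewrite (@word_UW 0 isT); vm_compute. Qed.

Lemma ip_w0_UW k : (k < 408)%N -> exists2 d, d \in [:: 0; 12; 18; 24; 36]%N &
  ip (wd 0) (wd k) = 36%:Z - (2 * d)%:Z.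
Proof.
move=> lt_k; exists (dis w0 (word k)).
  exact: (word_UW_all w0_UW_ok lt_k).
by rewrite ip_wd ?word0 //; apply: ltn_trans lt_k _.
Qed.

Lemma ip_w0_HW i : ip (wd 0) (row i H17) \in [:: 6; -6 : int].
Proof.
have lt_i : (408 + i < 444)%N by rewrite -[444%N]/(408 + 36)%N ltn_add2l.
rewrite row_H17 ip_wd ?word0 // word_HW.
have : dis w0 (nth [::] H17_rows i) \in [:: 15; 21]%N.
  by apply: (nth_size w0_HW_ok); rewrite size_mkseq.
by rewrite !inE => /orP[] /eqP->.
Qed.

(** Transported from [w0]: the inverse automorphism permutes the rows of H up to sign. *)
Lemma ip_UW_HW k i : (k < 408)%N -> ip (wd k) (row i H17) \in [:: 6; -6 : int].
Proof.
move=> /(UW_trans false)[P aP]; rewrite scale1r => <-.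
rewrite -(code_aut_tr_cancel (row i H17) aP) ip_monomial ?code_aut_monomial //.
have [i' [b ->]] := code_aut_H17 (code_aut_tr aP) i.
have := ip_w0_HW i'; rewrite ipZr !inE => /orP[] /eqP->; case: b; rewrite ?mulN1r ?mul1r //.
Qed.

Lemma UW_or_HW u : cword u ->
  (exists2 k, (k < 408)%N & exists b : bool, u = (-1) ^+ b *: wd k) \/
  (exists i, exists b : bool, u = (-1) ^+ b *: row i H17).
Proof.
case/words_complete=> k lt_k [b eq_u]; have [lt_k8|ge_k8] := ltnP k 408.
  by left; exists k => //; exists b.
have lt_i : (k - 408 < 36)%N by rewrite ltn_subLR.
by right; exists (Ordinal lt_i), b; rewrite eq_u row_H17 /= subnKC.
Qed.

Lemma code_aut_UW P k : P \in code_aut L17 -> (k < 408)%N ->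
  exists2 l, (l < 408)%N & exists b : bool, wd k *m lift3 P = (-1) ^+ b *: wd l.
Proof.
move=> aP lt_k; have lt_k4 : (k < 444)%N by apply: ltn_trans lt_k _.
case: (UW_or_HW (cword_aut aP (cword_wd lt_k4))) => // -[i [b eq_i]].
have [i' [b' eq_i']] := code_aut_H17 (code_aut_tr aP) i.
have : wd k = (-1) ^+ b *: ((-1) ^+ b' *: row i' H17).
  by rewrite -eq_i' scalemxAl -eq_i -mulmxA lift3_tr lift3_mulT ?mulmx1 ?code_aut_monomial.
(* The word would be a row of H up to sign, having inner product 36 or -36 with it instead of 6 or
   -6. *)
move=> eq_k; have := ip_UW_HW i' lt_k; rewrite eq_k !ipZl hadamard_ip ?hadamard_H17 // eqxx.
by case: (b) (b') => [] [].
Qed.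

(** Only distances from [w0] are computed. The list is closed under d -> 36 - d, which absorbs
    signs. *)
Lemma ip_UW k l : (k < 408)%N -> (l < 408)%N ->
  dis (word k) (word l) \in [:: 0; 12; 18; 24; 36]%N.
Proof.
move=> lt_k lt_l; have [P aP eqP] := UW_trans false lt_k; rewrite scale1r in eqP.
have [j lt_j [b eq_j]] := code_aut_UW (code_aut_tr aP) lt_l.
have [d d_in ip_d] := ip_w0_UW lt_j.
have : ip (wd k) (wd l) = (-1) ^+ b * (36%:Z - (2 * d)%:Z).
  rewrite -eqP -(code_aut_tr_cancel (wd l) aP) ip_monomial ?code_aut_monomial //.
  by rewrite eq_j ipZr ip_d.
rewrite ip_wd; [|exact: ltn_trans lt_k _|exact: ltn_trans lt_l _].
move: (dis _ _) => e; rewrite !inE in d_in *.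
by case: b {eq_j}; rewrite ?mulN1r ?mul1r => eq_e; lia.
Qed.

Lemma gcoefE d : d \in [:: 0; 12; 18; 24; 36]%N ->
  36%:Z - (2 * d)%:Z = 12 * ((gcoef d).1%:Z - (gcoef d).2%:Z).
Proof. by rewrite !inE; do 4?[case/predU1P=> [->//|]]; move/eqP->. Qed.

Definition gval (v u : nat) : int :=
  let c := gcoef (dis (word v) (word u)) in c.1%:Z - c.2%:Z.

Lemma ip_gval v u : (v < 408)%N -> (u < 408)%N -> ip (wd v) (wd u) = 12 * gval v u.
Proof.
move=> lt_v lt_u; rewrite ip_wd; [|exact: ltn_trans lt_v _|exact: ltn_trans lt_u _].
exact/gcoefE/ip_UW.
Qed.

Lemma lsumE n cs x : size cs = n -> size x = n ->
  (lsum cs x).1%:Z - (lsum cs x).2%:Z =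
  \sum_(i < n) (nth false x i)%:R * ((nth (0, 0)%N cs i).1%:Z - (nth (0, 0)%N cs i).2%:Z).
Proof.
elim: n cs x => [|n IHn] [|c cs] [|b x] //=; first by rewrite big_ord0.
move=> [sc] [sx]; rewrite big_ord_recl /= -IHn //.
by case: b; rewrite ?mul1r ?mul0r ?add0r //=; lia.
Qed.

Lemma size_gmuls a b : size a = size b -> size (gmuls a b) = size b.
Proof. by elim: a b => [|x a IHa] [|y b] //= [/IHa->]. Qed.

Lemma nth_gmuls a b i : size a = size b -> (i < size b)%N ->
  nth (0, 0)%N (gmuls a b) i = gmul (nth (0, 0)%N a i) (nth (0, 0)%N b i).
Proof. by elim: a b i => [|x a IHa] [|y b] [|i] //= [/IHa]; apply. Qed.

Lemma gmulE a b : (gmul a b).1%:Z - (gmul a b).2%:Z =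
  (a.1%:Z - a.2%:Z) * (b.1%:Z - b.2%:Z).
Proof. by rewrite /gmul /= !PoszD !PoszM; ring. Qed.

Definition cval (c : nat * nat) : int := c.1%:Z - c.2%:Z.

Lemma size_gram_of W n v : size W = n -> (v < n)%N ->
  size (nth [::] (gram_of W) v) = n.
Proof. by move=> sW lt_v; rewrite (nth_map [::]) ?size_map sW. Qed.

Lemma nth_gram_of W n v u : size W = n -> (v < n)%N -> (u < n)%N ->
  nth (0, 0)%N (nth [::] (gram_of W) v) u = gcoef (dis (nth [::] W v) (nth [::] W u)).
Proof. by move=> sW lt_v lt_u; rewrite !(nth_map [::]) ?sW. Qed.

Lemma parseval_eqnE W n v w x : size W = n -> size x = n -> (v < n)%N -> (w < n)%N ->
  let g k l := cval (gcoef (dis (nth [::] W k) (nth [::] W l))) in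
  let e := parseval_eqn (gram_of W) v w in
  cval (lsum e.1 x) = \sum_(i < n) (nth false x i)%:R * (g v i * g w i) /\
  e.2.1%:Z - e.2.2%:Z = 3 * g v w.
Proof.
move=> sW sx lt_v lt_w g e; have sv := size_gram_of sW lt_v; have sw := size_gram_of sW lt_w.
split; last by rewrite /= !(nth_gram_of sW) // /g /cval !PoszM; ring.
rewrite [LHS](@lsumE n) ?size_gmuls ?sv ?sw //; apply: eq_bigr => i _; congr (_ * _).
by rewrite nth_gmuls ?sv ?sw // gmulE !(nth_gram_of sW).
Qed.

(** [checkP] needs the equations for all indices, since those in a certificate are unbounded; out of
    range the equation is 0 = 0. *)
Lemma parseval_eqn_default W n v w x : size W = n -> (n <= v)%N || (n <= w)%N ->
  let e := parseval_eqn (gram_of W) v w in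
  ((lsum e.1 x).1 + e.2.2 = (lsum e.1 x).2 + e.2.1)%N.
Proof.
move=> sW; have big k : (n <= k)%N -> nth [::] (gram_of W) k = [::].
  by move=> le_k; rewrite nth_default // size_map sW.
have [/big e _|lt_v /= /big e] := leqP n v; rewrite /parseval_eqn e /=; first by rewrite nth_nil.
have := size_gram_of sW lt_v; case: (nth _ _ v) => [|c gv] sv; first by rewrite nth_nil.
have le_w : (n <= w)%N.
  by rewrite leqNgt; apply/negP => lt_w; have := size_gram_of sW lt_w; rewrite e => n0; rewrite -n0 in lt_v.
by rewrite nth_default ?sv.
Qed.

Lemma sum_codom (R : pzSemiRingType) (I J : finType) (f : I -> J) (F : J -> R) : injective f ->
  \sum_j (j \in codom f)%:R * F j = \sum_i F (f i).
Proof.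
move=> f_inj; transitivity (\sum_(j in codom f) F j).
  by rewrite [RHS]big_mkcond; apply: eq_bigr => j _; case: ifP; rewrite ?mul1r ?mul0r.
rewrite -big_uniq /=; last by rewrite codomE map_inj_uniq ?enum_uniq.
by rewrite codomE big_map big_enum.
Qed.

Lemma agree_start n x : size x = n.+1 -> nth false x 0 = true ->
  agree (Some true :: nseq n None) x.
Proof.
case: x => [|b x] //= [<-] -> /=; by elim: x.
Qed.

Lemma UW_uniq : uniq orbit_words. Proof. by vm_compute. Qed.
Lemma UW_head : all (fun s => ~~ head false s) orbit_words. Proof. by vm_compute. Qed.

Lemma sgv_inj n s t : size s = n -> size t = n -> sgv n s = sgv n t -> s = t.
Proof.
move=> ss st /rowP eq_st; apply: (@eq_from_nth _ false) => [|i]; rewrite ss ?st //.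
move=> lt_i; have := eq_st (Ordinal lt_i); rewrite !mxE /=.
by case: (nth _ s i); case: (nth _ t i).
Qed.

(** The listed words are distinct and begin with +1, so both index and sign can be recovered. *)
Lemma wd_inj k l (b c : bool) : (k < 408)%N -> (l < 408)%N ->
  (-1) ^+ b *: wd k = (-1) ^+ c *: wd l -> k = l /\ b = c.
Proof.
move=> lt_k lt_l eq_kl.
have w0 m : (m < 408)%N -> wd m 0 0 = 1.
  move=> lt_m; rewrite mxE nth0.
  by have /negPf-> := word_UW_all UW_head lt_m.
have eq_bc : b = c.
  move/rowP/(_ 0): eq_kl; rewrite [LHS]mxE [RHS]mxE !w0 //.
  by case: (b); case: (c).
move: eq_kl; rewrite eq_bc => /(congr1 (fun v => (-1) ^+ c *: v)).
rewrite !scalerA -signr_addb addbb !scale1r => /sgv_inj eq_w; split=> //.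
apply/eqP; rewrite -(nth_uniq [::] _ _ UW_uniq) ?size_UW // -!word_UW //.
by apply/eqP/eq_w; apply: size_word; [exact: ltn_trans lt_k _|exact: ltn_trans lt_l _].
Qed.

Lemma frame_index M : hadamard M -> (forall i, cword (row i M)) ->
    (exists j, exists b : bool, row j M = (-1) ^+ b *: wd 0) ->
  exists2 f : 'I_36 -> 'I_408, injective f &
    exists b : 'I_36 -> bool, forall j, row j M = (-1) ^+ b j *: wd (f j).
Proof.
move=> hM cM [j0 [b0 eq0]].
have ex j : exists k : 'I_408, exists b : bool, row j M = (-1) ^+ b *: wd k.
  case: (UW_or_HW (cM j)) => [[k lt_k [b eq_j]]|[i [b eq_j]]].
    by exists (Ordinal lt_k), b.
  (* A row of H is impossible: its inner product with the first word is 6 or -6, whereas rows of M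
     give 0 or 36. *)
  have := hadamard_ip j0 j hM; rewrite eq0 eq_j ipZr ipZl.
  have := ip_w0_HW i; rewrite !inE => /orP[] /eqP->; case: (j0 == j); case: (b); case: (b0) => //.
have [f /fin_all_exists[b fP]] := fin_all_exists ex.
exists f; last by exists b.
move=> i j eq_f; apply/eqP/negPn/negP => ne_ij.
have := hadamard_ip i j hM; rewrite (negPf ne_ij) !fP eq_f ipZl ipZr.
have := hadamard_ip j j hM; rewrite eqxx fP ipZl ipZr.
by case: (b i) (b j) => [] [];
  rewrite ?mulN1r ?mul1r ?opprK // => -> /eqP; rewrite ?oppr_eq0.
Qed.

Lemma frame_classification M : hadamard M -> (forall i, cword (row i M)) ->
    (exists j, exists b : bool, row j M = (-1) ^+ b *: wd 0) ->
  exists k, forall j, exists2 u, (u < 408)%N /\ u \in map nat_of_bin (nth [::] frames0 k) &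
    exists b : bool, row j M = (-1) ^+ b *: wd u.
Proof.
move=> hM cM row0; have [f f_inj [b fP]] := frame_index hM cM row0.
have [j0 [b0 eq0]] := row0.
pose x := [seq u \in codom f | u <- enum 'I_408].
have sx : size x = 408%N by rewrite size_map size_enum_ord.
have xE (u : 'I_408) : nth false x u = (u \in codom f).
  by rewrite (nth_map u) ?size_enum_ord // nth_ord_enum.
have x0 : nth false x 0 = true.
  have [f0 _] : f j0 = 0%N :> nat /\ b j0 = b0 by apply: wd_inj => //; rewrite -fP.
  by rewrite -{1}f0 xE codom_f.
have eqn_x v w : let e := parseval_eqn (gram_of orbit_words) v w in
    ((lsum e.1 x).1 + e.2.2 = (lsum e.1 x).2 + e.2.1)%N.
  have [lt_v|ge_v] := ltnP v 408; last first.
    by refine (parseval_eqn_default x size_UW _); rewrite ge_v.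
  have [lt_w|ge_w] := ltnP w 408; last first.
    by refine (parseval_eqn_default x size_UW _); rewrite ge_w orbT.
  have [] := parseval_eqnE size_UW sx lt_v lt_w.
  move: (parseval_eqn _ _ _) => [cs [tp tm]] /=; rewrite /cval.
  have gE k l : (k < 408)%N -> (l < 408)%N ->
      (gcoef (dis (nth [::] orbit_words k) (nth [::] orbit_words l))).1%:Z -
      (gcoef (dis (nth [::] orbit_words k) (nth [::] orbit_words l))).2%:Z = gval k l.
    by move=> lt_k lt_l; rewrite /gval !word_UW.
  rewrite gE //.
  under eq_bigr => i _ do rewrite 2?gE // xE.
  rewrite (sum_codom (fun i : 'I_408 => gval v i * gval w i)) //.
  (* Parseval's identity for the rows of M; the sign of each row occurs twice and cancels. *)
  have : 36%:Z * (12 * gval v w) = 144 * \sum_j gval v (f j) * gval w (f j).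
    rewrite -ip_gval // -(hadamard_parseval _ _ hM) mulr_sumr; apply: eq_bigr => j _.
    by rewrite fP !ipZr !ip_gval // mulrACA -signr_addb addbb mul1r mulrACA.
  by move=> e1 e2 e3; lia.
have [k in_k] := checkP eqn_x (agree_start sx x0) search_ok.
exists k => j; exists (f j : nat); last by exists (b j).
by split=> //; apply: in_k; rewrite xE codom_f.
Qed.

(** * Classification of the Hadamard matrices *)

(* The stabilizer of the first word; its k-th element maps the k-th frame of
   [frames0] to the frame number 4, which is the one taken as H'. *)
Definition stab0 : seq (seq N) :=
  [:: [:: 15; 2; 20; 31; 24; 13; 11; 1; 19; 17; 4; 33; 8; 26; 34; 7; 23; 28; 50; 38;
   56; 67; 60; 49; 47; 36; 55; 53; 40; 69; 44; 62; 70; 43; 59; 64];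
     [:: 15; 17; 13; 2; 34; 4; 11; 20; 7; 33; 1; 31; 23; 8; 19; 24; 28; 26; 50; 53;
   49; 38; 70; 40; 47; 56; 43; 69; 36; 67; 59; 44; 55; 60; 64; 62];
     [:: 5; 31; 13; 18; 26; 10; 21; 14; 3; 35; 1; 9; 7; 28; 23; 32; 16; 24; 40; 67;
   49; 54; 62; 46; 57; 50; 39; 71; 36; 45; 43; 64; 59; 68; 52; 60];
     [:: 5; 18; 14; 9; 32; 13; 21; 1; 23; 31; 10; 35; 28; 24; 26; 3; 7; 16; 40; 54;
   50; 45; 68; 49; 57; 36; 59; 67; 46; 71; 64; 60; 62; 39; 43; 52];
     [:: 0; 2; 4; 6; 8; 10; 12; 14; 16; 18; 20; 22; 24; 26; 28; 30; 32; 34; 36; 38;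
   40; 42; 44; 46; 48; 50; 52; 54; 56; 58; 60; 62; 64; 66; 68; 70];
     [:: 0; 18; 10; 2; 28; 20; 12; 4; 30; 22; 14; 6; 32; 24; 16; 8; 34; 26; 36; 54;
   46; 38; 64; 56; 48; 40; 66; 58; 50; 42; 68; 60; 52; 44; 70; 62];
     [:: 21; 6; 10; 17; 26; 13; 5; 1; 3; 29; 14; 25; 30; 34; 32; 23; 19; 8; 56; 42;
   46; 53; 62; 49; 41; 36; 39; 65; 50; 61; 66; 70; 68; 59; 55; 44];
     [:: 21; 17; 1; 25; 23; 10; 5; 14; 32; 6; 13; 29; 34; 8; 26; 3; 30; 19; 56; 53;
   36; 61; 59; 46; 41; 50; 68; 42; 49; 65; 70; 44; 62; 39; 66; 55];
     [:: 12; 33; 20; 35; 28; 10; 0; 14; 30; 25; 4; 27; 19; 23; 8; 16; 3; 7; 49; 69;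
   56; 71; 64; 46; 37; 50; 66; 61; 40; 63; 55; 59; 44; 52; 39; 43];
     [:: 12; 25; 10; 33; 8; 4; 0; 20; 16; 27; 14; 35; 3; 19; 30; 28; 7; 23; 49; 61;
   46; 69; 44; 40; 37; 56; 52; 63; 50; 71; 39; 55; 66; 64; 43; 59];
     [:: 15; 33; 4; 17; 19; 1; 11; 13; 24; 31; 20; 2; 28; 23; 7; 34; 26; 8; 50; 69;
   40; 53; 55; 36; 47; 49; 60; 67; 56; 38; 64; 59; 43; 70; 62; 44];
     [:: 15; 31; 1; 33; 7; 20; 11; 4; 34; 2; 13; 17; 26; 28; 24; 19; 8; 23; 50; 67;
   36; 69; 43; 56; 47; 40; 70; 38; 49; 53; 62; 64; 60; 55; 44; 59];
     [:: 11; 9; 13; 22; 24; 20; 15; 4; 19; 27; 1; 29; 3; 16; 7; 34; 30; 32; 46; 45;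
   49; 58; 60; 56; 51; 40; 55; 63; 36; 65; 39; 52; 43; 70; 66; 68];
     [:: 12; 27; 4; 25; 30; 14; 0; 10; 28; 35; 20; 33; 7; 3; 16; 8; 23; 19; 49; 63;
   40; 61; 66; 50; 37; 46; 64; 71; 56; 69; 43; 39; 52; 44; 59; 55];
     [:: 12; 35; 14; 27; 16; 20; 0; 4; 8; 33; 10; 25; 23; 7; 28; 30; 19; 3; 49; 71;
   50; 63; 52; 56; 37; 40; 44; 69; 46; 61; 59; 43; 64; 66; 55; 39];
     [:: 11; 27; 20; 9; 7; 1; 15; 13; 34; 29; 4; 22; 30; 3; 19; 24; 32; 16; 46; 63;
   56; 45; 43; 36; 51; 49; 70; 65; 40; 58; 66; 39; 55; 60; 68; 52];
     [:: 5; 9; 1; 35; 3; 14; 21; 10; 26; 18; 13; 31; 24; 16; 32; 23; 28; 7; 40; 45;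
   36; 71; 39; 50; 57; 46; 62; 54; 49; 67; 60; 52; 68; 59; 64; 43];
     [:: 5; 35; 10; 31; 23; 1; 21; 13; 32; 9; 14; 18; 16; 7; 3; 26; 24; 28; 40; 71;
   46; 67; 59; 36; 57; 49; 68; 45; 50; 54; 52; 43; 39; 62; 60; 64];
     [:: 21; 29; 13; 6; 32; 14; 5; 10; 23; 25; 1; 17; 19; 30; 3; 26; 8; 34; 56; 65;
   49; 42; 68; 50; 41; 46; 59; 61; 36; 53; 55; 66; 39; 62; 44; 70];
     [:: 0; 6; 14; 22; 30; 4; 12; 20; 28; 2; 10; 18; 26; 34; 8; 16; 24; 32; 36; 42;
   50; 58; 66; 40; 48; 56; 64; 38; 46; 54; 62; 70; 44; 52; 60; 68];
     [:: 21; 25; 14; 29; 3; 1; 5; 13; 26; 17; 10; 6; 8; 19; 23; 32; 34; 30; 56; 61;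
   50; 65; 39; 36; 41; 49; 62; 53; 46; 42; 44; 55; 59; 68; 70; 66];
     [:: 0; 22; 20; 18; 16; 14; 12; 10; 8; 6; 4; 2; 34; 32; 30; 28; 26; 24; 36; 58;
   56; 54; 52; 50; 48; 46; 44; 42; 40; 38; 70; 68; 66; 64; 62; 60];
     [:: 11; 29; 1; 27; 19; 4; 15; 20; 24; 22; 13; 9; 32; 30; 34; 7; 16; 3; 46; 65;
   36; 63; 55; 40; 51; 56; 60; 58; 49; 45; 68; 66; 70; 43; 52; 39];
     [:: 11; 22; 4; 29; 34; 13; 15; 1; 7; 9; 20; 27; 16; 32; 24; 19; 3; 30; 46; 58;
   40; 65; 70; 49; 51; 36; 43; 45; 56; 63; 52; 68; 60; 55; 39; 66]]%num.
(** A word of the orbit has inner product 6 or -6 with the all-one row of H, hence 15 or 21 entries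
    -1. Choosing 21 throughout makes the matrix regular, with 15 points on each block. *)
Definition fnorm (s : seq bool) : seq bool :=
  if count id s == 21%N then s else map negb s.

Definition frame_ix (k : nat) : seq nat := map nat_of_bin (nth [::] frames0 k).
Definition stab (k : nat) : seq nat := map nat_of_bin (nth [::] stab0 k).

Definition F17_rows : seq (seq bool) := [seq fnorm (nth [::] orbit_words u) | u <- frame_ix 4].

Definition F17 : 'M[int]_36 := bmx 36 F17_rows.

Lemma FW_ok : had_ok F17_rows. Proof. by vm_compute. Qed.
Lemma FW_incode : all incode F17_rows. Proof. by vm_compute. Qed.
Lemma FW_count : all (fun s => count id s == 21%N) F17_rows. Proof. by vm_compute. Qed.

Lemma size_FW : size F17_rows = 36%N. Proof. by vm_compute. Qed.

Lemma size_FWi i : (i < 36)%N -> size (nth [::] F17_rows i) = 36%N.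
Proof.
move=> lt_i; have ok : all (fun s => size s == 36%N) F17_rows by case/andP: FW_ok => /andP[].
by apply/eqP; apply: (nth_size ok); rewrite size_FW.
Qed.

Lemma hadamard_F17 : hadamard F17. Proof. exact: had_okP FW_ok. Qed.

Lemma cword_F17 i : cword (row i F17).
Proof.
rewrite row_bmx; apply: cword_sgv; first by rewrite size_FWi.
by apply: (nth_size FW_incode); rewrite size_FW.
Qed.

Lemma sgv_fnorm n s : size s = n ->
  exists b : bool, sgv n (fnorm s) = (-1) ^+ b *: sgv n s.
Proof.
move=> ss; rewrite /fnorm; case: ifP => _; first by exists false; rewrite scale1r.
by exists true; rewrite sgvN // scaleN1r.
Qed.

Definition stab_ok_at (k : nat) : bool :=
  let q := stab k in
  [&& gen_ok q, act q w0 == w0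
    & all (fun u => fnorm (act q (nth [::] orbit_words u)) \in F17_rows) (frame_ix k)].

Lemma stab_ok : all stab_ok_at (iota 0 24). Proof. by vm_compute. Qed.

Lemma size_frames0 : size frames0 = 24%N. Proof. by []. Qed.

Definition Q0 (k : nat) : 'M['F_3]_36 := gmx 36 (stab k).

Lemma stab_okP k : (k < 24)%N -> stab_ok_at k.
Proof. by move=> lt_k; apply: (allP stab_ok); rewrite mem_iota. Qed.

Lemma Q0_aut k : (k < 24)%N -> Q0 k \in code_aut L17.
Proof. by move/stab_okP => /and3P[/gen_okP]. Qed.

Lemma Q0_wd0 k : (k < 24)%N -> wd 0 *m lift3 (Q0 k) = wd 0.
Proof.
move/stab_okP => /and3P[/andP[qP _] /eqP q0 _].
by rewrite wd0 sgv_act // q0.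
Qed.

Lemma mem_row n (T : seq (seq bool)) s : s \in T -> size T = n ->
  exists i : 'I_n, nth [::] T i = s.
Proof.
move=> sT nT; have lt_i : (index s T < n)%N by rewrite -nT index_mem.
by exists (Ordinal lt_i); rewrite /= nth_index.
Qed.

Lemma Q0_frame k u : (k < 24)%N -> u \in frame_ix k -> (u < 408)%N ->
  exists i, exists b : bool, wd u *m lift3 (Q0 k) = (-1) ^+ b *: row i F17.
Proof.
move/stab_okP => /and3P[qP _ /allP qF] /qF uF lt_u.
have [i] := mem_row uF size_FW; rewrite -(word_UW lt_u) => {qF uF} eq_i.
have [b eq_b] := sgv_fnorm (size_act (word u) qP).
exists i, b; rewrite row_bmx eq_i eq_b scalerA -signr_addb addbb scale1r.
by rewrite sgv_act //; case/andP: qP.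
Qed.

Lemma frame_equiv M : hadamard M -> (forall i, cword (row i M)) ->
    (exists j, exists b : bool, row j M = (-1) ^+ b *: wd 0) ->
  exists2 k, (k < 24)%N & maps_rows M (Q0 k) F17.
Proof.
move=> hM cM row0; have [k in_k] := frame_classification hM cM row0.
(* Beyond the list the default frame is empty, but M has a row. *)
have lt_k : (k < 24)%N.
  rewrite -size_frames0 ltnNge; apply/negP => ge_k; have [u [_]] := in_k ord0.
  by rewrite nth_default.
exists k => // j; have [u [lt_u u_k] [b ->]] := in_k j.
have [i [c eq_c]] := Q0_frame lt_k u_k lt_u.
by exists i, (b (+) c); rewrite -scalemxAl eq_c scalerA signr_addb.
Qed.

Lemma hadamard_mono n (M : 'M[int]_n) P : hadamard M -> monomial_mx P ->
  hadamard (M *m lift3 P).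
Proof.
move=> /andP[/forallP pm /eqP eqM] mP; apply/andP; split; last first.
  by rewrite trmx_mul mulmxA -(mulmxA M) lift3_mulT // mulmx1 eqM.
case/monomialP: mP => s [b ->]; rewrite lift3_mono; apply/forallP=> i; apply/forallP=> j.
rewrite mulmx_mono; have /forallP/(_ (s^-1%g j)) := pm i.
by case/orP=> /eqP->; case: (b _).
Qed.

Lemma maps_rows_mul n (M B : 'M[int]_n) P Q : monomial_mx P -> monomial_mx Q ->
  maps_rows (M *m lift3 P) Q B -> maps_rows M (P *m Q) B.
Proof.
move=> mP mQ mMB i; have [i' [b eq_i]] := mMB i; exists i', b.
by rewrite lift3_mul // mulmxA -row_mul.
Qed.

(** One row decides. If it belongs to the orbit, an automorphism moves it to [w0], where the frames
    are known. If it is a row of H, no word of the orbit is orthogonal to it, so all rows come from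
    H. *)
Lemma hadamard_code_classification M : hadamard_in_code L17 M ->
  hadamard_equiv M H17 \/ hadamard_equiv M F17.
Proof.
rewrite hadamard_in_codeE => /andP[hM /forallP cM].
case: (UW_or_HW (cM ord0)) => [[k lt_k [b eq_0]]|[i [b eq_0]]].
  right; have [T aT eqT] := UW_trans b lt_k.
  have aT' := code_aut_tr aT; have mT' := code_aut_monomial aT'.
  have [||l lt_l mMF] := @frame_equiv (M *m lift3 T^T) (hadamard_mono hM mT').
  - by move=> i; rewrite row_mul; apply: cword_aut.
  - exists ord0, false; rewrite scale1r row_mul eq_0 -eqT -mulmxA lift3_tr lift3_mulT ?mulmx1 //.
    exact: code_aut_monomial.
  have mQ := code_aut_monomial (Q0_aut lt_l).
  have [L LP] := maps_rows_isom hM (monomial_mul mT' mQ) (maps_rows_mul mT' mQ mMF).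
  by exists (L, T^T *m Q0 l).
left; have m1 := code_aut_monomial code_aut1.
have [|L LP] := maps_rows_isom hM m1 (_ : maps_rows M 1%:M H17); last by exists (L, 1%:M).
move=> j; rewrite -(mono1 'F_3) lift3_mono mono1 mulmx1.
case: (UW_or_HW (cM j)) => [[k lt_k [c eq_c]]|//].
have := hadamard_ip j ord0 hM; rewrite eq_c eq_0 ipZl ipZr.
by have := ip_UW_HW i lt_k; rewrite !inE => /orP[] /eqP->;
  case: (j == ord0); case: (b); case: (c).
Qed.

Lemma F17_in_code : hadamard_in_code L17 F17.
Proof.
by rewrite hadamard_in_codeE hadamard_F17; apply/forallP => i; apply: cword_F17.
Qed.

Lemma H17_in_code : hadamard_in_code L17 H17.
Proof.
by rewrite hadamard_in_codeE hadamard_H17; apply/forallP => i; apply: cword_H17.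
Qed.

(** * Rigidity and the order of the automorphism group *)

Definition xorl (s t : seq bool) : seq bool := [seq p.1 (+) p.2 | p <- zip s t].

Definition quad n (u v x y : 'rV[int]_n) : int :=
  \sum_j u 0 j * v 0 j * (x 0 j * y 0 j).

(** Each column sign occurs four times in its term and cancels. *)
Lemma quad_monomial n (P : 'M['F_3]_n) u v x y : monomial_mx P ->
  quad (u *m lift3 P) (v *m lift3 P) (x *m lift3 P) (y *m lift3 P) = quad u v x y.
Proof.
case/monomialP=> s [b ->]; rewrite lift3_mono /quad (reindex_inj (@perm_inj _ s)) /=.
apply: eq_bigr => j _; rewrite !mulmx_mono permK.
by case: (b j); rewrite ?mulr1 // !mulrN1 !mulrNN.
Qed.

Lemma sgv_xorl n s t j : size s = n -> size t = n ->
  sgv n (xorl s t) 0 j = sgv n s 0 j * sgv n t 0 j.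
Proof.
move=> ss st; rewrite !mxE -signr_addb (nth_map (false, false)) ?size_zip ?ss ?st ?minnn //.
by rewrite nth_zip ?ss.
Qed.

Lemma quad_sgv n r s t u : size r = n -> size s = n -> size t = n -> size u = n ->
  quad (sgv n r) (sgv n s) (sgv n t) (sgv n u) = n%:Z - (2 * dis (xorl r s) (xorl t u))%:Z.
Proof.
move=> sr ss st su; rewrite -ip_sgv ?size_map ?size_zip ?sr ?ss ?st ?su ?minnn //.
by rewrite ipE; apply: eq_bigr => j _; rewrite !sgv_xorl.
Qed.

(* Any even function would give an invariant; this one separates the rows. *)
Definition psi (x : int) : nat :=
  match `|x|%N with 14 => 1 | 18 => 3 | 22 => 6 | _ => 0 end.

Lemma psi_sign (b : bool) x : psi ((-1) ^+ b * x) = psi x.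
Proof. by rewrite /psi abszMsign. Qed.

Lemma quad_scale n a b c d (u v x y : 'rV[int]_n) :
  quad (a *: u) (b *: v) (c *: x) (d *: y) = a * b * c * d * quad u v x y.
Proof.
by rewrite /quad mulr_sumr; apply: eq_bigr => j _; rewrite !mxE; ring.
Qed.

Lemma quad_sign n (a b c d : bool) (u v x y : 'rV[int]_n) :
  psi (quad ((-1) ^+ a *: u) ((-1) ^+ b *: v) ((-1) ^+ c *: x) ((-1) ^+ d *: y))
  = psi (quad u v x y).
Proof. by rewrite quad_scale -!signr_addb psi_sign. Qed.

Section Invariants.

Variable n : nat.
Implicit Types (M : 'M[int]_n) (P : 'M['F_3]_n).

(** The weight [w] may itself be an invariant of the rows, so that one invariant refines another. *)
Definition quad_inv M (w : 'I_n -> nat) (u v : 'rV[int]_n) : nat :=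
  (\sum_i \sum_j psi (quad u v (row i M) (row j M)) * w j)%N.

Lemma quad_inv_sign M w u v (a b : bool) :
  quad_inv M w ((-1) ^+ a *: u) ((-1) ^+ b *: v) = quad_inv M w u v.
Proof.
apply: eq_bigr => i _; apply: eq_bigr => j _; congr (_ * _)%N.
by rewrite -[row i M]scale1r -[row j M]scale1r (quad_sign a b false false) !scale1r.
Qed.

Lemma quad_inv_maps M P f (b : 'I_n -> bool) w u v :
    monomial_mx P -> injective f ->
    (forall i, row i M *m lift3 P = (-1) ^+ b i *: row (f i) M) ->
    (forall i, w (f i) = w i) ->
  quad_inv M w (u *m lift3 P) (v *m lift3 P) = quad_inv M w u v.
Proof.
move=> mP f_inj fP wf; rewrite /quad_inv (reindex_inj f_inj) /=.
apply: eq_bigr => i _; rewrite (reindex_inj f_inj); apply: eq_bigr => j _ /=.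
rewrite wf -(quad_monomial u v (row i M) (row j M) mP) !fP; congr (_ * _)%N.
rewrite -[u *m _]scale1r -[v *m _]scale1r (quad_sign false false (b i) (b j)).
by rewrite !scale1r.
Qed.

Lemma ip_nondeg (u v : 'rV[int]_n) : (forall w, ip u w = ip v w) -> u = v.
Proof.
move=> eq_uv; apply/rowP=> j; have := eq_uv (delta_mx 0 j).
by rewrite /ip trmx_delta -!colE !mxE.
Qed.

(** The rows of M span the rational space; Parseval's identity expresses this without leaving the
    integers. *)
Lemma hadamard_fixed M P : hadamard M -> monomial_mx P ->
  (forall i, row i M *m lift3 P = row i M) -> P = 1%:M.
Proof.
move=> hM mP fP; apply: lift3_inj; apply/row_matrixP=> i.
have n_gt0 : (0 < n)%N by apply: leq_ltn_trans (ltn_ord i).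
suff uP (u : 'rV[int]_n) : u *m lift3 P = u.
  by rewrite -[lift3 P]mul1mx row_mul uP -(mono1 'F_3) lift3_mono mono1.
apply: ip_nondeg => w; apply: (@mulfI _ n%:R); first by rewrite pnatr_eq0 -lt0n.
rewrite -!(hadamard_parseval _ _ hM); apply: eq_bigr => j _; congr (_ * _).
by rewrite -{1}[row j M]fP ip_monomial.
Qed.

End Invariants.

Definition ones : seq bool := nseq 36 false.

Lemma row_H17_0 : row ord0 H17 = sgv 36 ones.
Proof. by rewrite H17E row_bmx; congr sgv; vm_compute. Qed.

Definition quad_table : seq (seq (seq bool)) := [seq [seq xorl x y | y <- F17_rows] | x <- F17_rows].

Definition psi_dis (s t : seq bool) : nat := psi (36%:Z - (2 * dis s t)%:Z).

Definition wsum (F : seq bool -> nat) (w : seq nat) (T : seq (seq bool)) : nat :=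
  foldr (fun p acc => F p.1 * p.2 + acc)%N 0%N (zip T w).

Definition inv_list (T : seq (seq (seq bool))) (w : seq nat) (s t : seq bool) : nat :=
  let st := xorl s t in sumn [seq wsum (psi_dis st) w r | r <- T].

Lemma wsumE F w T n : size w = n -> size T = n ->
  wsum F w T = (\sum_(j < n) F (nth [::] T j) * nth 0 w j)%N.
Proof.
elim: n w T => [|n IHn] [|c w] [|x T] //=; first by rewrite big_ord0.
by move=> [sw] [sT]; rewrite big_ord_recl /= -IHn.
Qed.

Lemma inv_listE W (w : seq nat) s t : size W = 36%N -> size w = 36%N ->
    (forall i : 'I_36, size (nth [::] W i) = 36%N) -> size s = 36%N -> size t = 36%N ->
  inv_list [seq [seq xorl x y | y <- W] | x <- W] w s t =
  quad_inv (bmx 36 W) (fun j => nth 0%N w j) (sgv 36 s) (sgv 36 t).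
Proof.
move=> sW sw sWi ss st; rewrite /inv_list -map_comp sumnE big_map (big_nth [::]) sW.
rewrite big_mkord; apply: eq_bigr => i _ /=; rewrite (@wsumE _ _ _ 36) ?size_map //.
apply: eq_bigr => j _; rewrite (nth_map [::]) ?sW // !row_bmx quad_sgv //.
Qed.

Definition wt1 : seq nat := nseq 36 1%N.
(** The first invariant, taken relative to the all-one word, becomes the weight of the second; its
    residue modulo 9 is still invariant. *)
Definition wt2 : seq nat := [seq (inv_list quad_table wt1 s ones %% 9)%N | s <- F17_rows].

Lemma row_inv_ok : uniq [seq inv_list quad_table wt2 s ones | s <- F17_rows].
Proof. by vm_compute. Qed.

(** Singles out the all-one row: a code automorphism fixing [w0] and preserving H' up to signs
    permutes the rows of H up to sign, so it must fix this one up to sign. *)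
Lemma base_inv_ok :
  all (fun h => inv_list quad_table wt1 w0 h != inv_list quad_table wt1 w0 ones) (behead H17_rows).
Proof. by vm_compute. Qed.

Lemma F17_inv w s t : size w = 36%N -> size s = 36%N -> size t = 36%N ->
  inv_list quad_table w s t =
  quad_inv F17 (fun j => nth 0%N w j) (sgv 36 s) (sgv 36 t).
Proof. by move=> sw ss st; exact: (inv_listE size_FW sw (fun i => size_FWi (ltn_ord i)) ss st). Qed.

Definition inv1 := quad_inv F17 (fun j => nth 0%N wt1 j).
Definition inv2 := quad_inv F17 (fun j => nth 0%N wt2 j).

Lemma size_wt2 : size wt2 = 36%N. Proof. by rewrite size_map size_FW. Qed.

Lemma nth_wt2 (j : 'I_36) : nth 0%N wt2 j = (inv1 (row j F17) (sgv 36 ones) %% 9)%N.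
Proof.
rewrite (nth_map [::]) ?size_FW // F17_inv ?size_FWi //.
by rewrite /inv1 row_bmx.
Qed.

Lemma uniq_map_inj (T : Type) (U : eqType) (x0 : T) (F : T -> U) W n (i j : 'I_n) :
  size W = n -> uniq (map F W) -> F (nth x0 W i) = F (nth x0 W j) -> i = j.
Proof.
move=> sW uW eq_ij; have lt_W (k : 'I_n) : (k < size W)%N by rewrite sW.
apply: val_inj; apply/eqP; rewrite -[_ == _](nth_uniq (F x0) _ _ uW) ?size_map ?lt_W //.
by rewrite !(nth_map x0 (F x0) F) ?lt_W // eq_ij.
Qed.

Lemma inv2_inj (i j : 'I_36) :
  inv2 (row i F17) (sgv 36 ones) = inv2 (row j F17) (sgv 36 ones) -> i = j.
Proof.
have e2 (k : 'I_36) : inv2 (row k F17) (sgv 36 ones) =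
    inv_list quad_table wt2 (nth [::] F17_rows k) ones.
  by rewrite F17_inv ?size_FWi ?size_wt2 // /inv2 row_bmx.
rewrite !e2 => eq_ij; exact: (uniq_map_inj size_FW row_inv_ok eq_ij).
Qed.

Lemma inv1_base (i : 'I_36) :
  inv1 (wd 0) (row i H17) = inv1 (wd 0) (sgv 36 ones) -> i = ord0.
Proof.
have e1 s : size s = 36%N -> inv1 (wd 0) (sgv 36 s) = inv_list quad_table wt1 w0 s.
  by move=> ss; rewrite F17_inv // /inv1 wd0.
case: i => [[|i] lt_i]; first by move=> _; apply: val_inj.
have lt_i' : (i < size (behead H17_rows))%N by rewrite size_behead size_mkseq.
have sH : size (nth [::] H17_rows i.+1) = 36%N.
  have ok : all (fun s => size s == 36%N) H17_rows by case/andP: HW_ok => /andP[].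
  by apply/eqP; apply: (nth_size ok); rewrite size_mkseq.
have := nth_size base_inv_ok lt_i'; rewrite nth_behead -!e1 // => ne eq_i; case/eqP: ne.
by move: eq_i; rewrite H17E row_bmx.
Qed.

Lemma dis_nseq n s : size s = n -> dis s (nseq n false) = count id s.
Proof. by move<-; elim: s => [|[] s IHs] //=; rewrite IHs. Qed.

Lemma ip_F17_ones (i : 'I_36) : ip (row i F17) (sgv 36 ones) = -6.
Proof.
rewrite row_bmx ip_sgv ?size_FWi //.
rewrite dis_nseq ?size_FWi //.
have lt_i : (i < size F17_rows)%N by rewrite size_FW.
by rewrite (eqP (nth_size FW_count lt_i)).
Qed.

Lemma rigid_ones P : monomial_mx P -> maps_rows F17 P F17 ->
  sgv 36 ones *m lift3 P = sgv 36 ones -> P = 1%:M.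
Proof.
move=> mP /(maps_rows_fun hadamard_F17 mP)[f f_inj [b fP]] eP.
have w1 (i : 'I_36) : nth 0%N wt1 i = 1%N by rewrite nth_nseq ltn_ord.
have sgn1 (u : 'rV[int]_36) : (-1) ^+ false *: u = u by rewrite scale1r.
have i1 j : inv1 (row (f j) F17) (sgv 36 ones) = inv1 (row j F17) (sgv 36 ones).
  rewrite -[LHS](quad_inv_sign _ _ _ _ (b j) false) sgn1 -fP -{1}eP.
  by apply: quad_inv_maps fP _ => // i; rewrite !w1.
have i2 j : inv2 (row (f j) F17) (sgv 36 ones) = inv2 (row j F17) (sgv 36 ones).
  rewrite -[LHS](quad_inv_sign _ _ _ _ (b j) false) sgn1 -fP -{1}eP.
  by apply: (quad_inv_maps _ _ mP f_inj fP) => i; rewrite !nth_wt2 i1.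
apply: (hadamard_fixed hadamard_F17 mP) => i.
have fi := inv2_inj (i2 i); have := fP i; rewrite fi.
(* A change of sign would negate the inner product -6 with the fixed all-one word. *)
case: (b i) => [|->]; last by rewrite scale1r.
move/(congr1 (fun u => ip u (sgv 36 ones *m lift3 P))).
by rewrite ip_monomial // eP ipZl ip_F17_ones.
Qed.

Lemma ip_wd0_ones : ip (wd 0) (sgv 36 ones) != 0.
Proof. by rewrite -row_H17_0; have := ip_w0_HW ord0; rewrite !inE => /orP[] /eqP->. Qed.

Lemma rigid_wd0 P : P \in code_aut L17 -> maps_rows F17 P F17 ->
  wd 0 *m lift3 P = wd 0 -> P = 1%:M.
Proof.
move=> aP mF P0; have mP := code_aut_monomial aP; apply: rigid_ones => //.
have [i [b eq_i]] := code_aut_H17 aP ord0; rewrite row_H17_0 in eq_i.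
have sgn1 (u : 'rV[int]_36) : (-1) ^+ false *: u = u by rewrite scale1r.
have i0 : i = ord0.
  apply: inv1_base; rewrite -[LHS](quad_inv_sign _ _ _ _ false b) sgn1 -eq_i -{1}P0.
  have [f f_inj [c fP]] := maps_rows_fun hadamard_F17 mP mF.
  by apply: quad_inv_maps fP _ => // j; rewrite !nth_nseq !ltn_ord.
(* The sign is + because the fixed word [wd 0] is not orthogonal to the all-one word. *)
rewrite i0 row_H17_0 in eq_i; case: b eq_i => [eq_i|->]; last by rewrite scale1r.
have := ip_monomial (wd 0) (sgv 36 ones) mP; rewrite P0 eq_i ipZr mulN1r.
by move/eqP; rewrite eq_sym -addr_eq0 -mulr2n mulrn_eq0 /= (negPf ip_wd0_ones).
Qed.

Lemma FW0 : nth [::] F17_rows 0 = w0. Proof. by vm_compute. Qed.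

Lemma row_F17_0 : row ord0 F17 = wd 0.
Proof. by rewrite row_bmx FW0 wd0. Qed.

(* The frame F17 P passes through the first word, hence is one of the 24 frames
   found by the search, and rigidity identifies P with the element of [stab0]
   that maps this frame back to F17. *)
Lemma stab_wd0 P : P \in code_aut L17 -> wd 0 *m lift3 P = wd 0 ->
  exists2 k, (k < 24)%N & P = (Q0 k)^T.
Proof.
move=> aP P0; have mP := code_aut_monomial aP.
have [||k lt_k mF] := @frame_equiv (F17 *m lift3 P) (hadamard_mono hadamard_F17 mP).
- by move=> i; rewrite row_mul; apply: cword_aut aP (cword_F17 i).
- by exists ord0, false; rewrite scale1r row_mul row_F17_0.
exists k => //; have aQ := Q0_aut lt_k; have mQ := code_aut_monomial aQ.
have PQ1 : P *m Q0 k = 1%:M.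
  apply: rigid_wd0; first exact: code_aut_mul.
    exact: maps_rows_mul.
  by rewrite lift3_mul // mulmxA P0 Q0_wd0.
by rewrite -[P]mulmx1 -(monomial_mulT mQ) mulmxA PQ1 mul1mx.
Qed.

(** * The order of the automorphism group *)

Definition probe : seq bool := false :: true :: nseq 34 false.

Lemma stab_uniq : uniq (mkseq (fun k => act (stab k) probe) 24).
Proof. by vm_compute. Qed.

Lemma Q0_inj (k l : 'I_24) : Q0 k = Q0 l -> k = l.
Proof.
have sp (m : 'I_24) : sperm 36 (stab m).
  by have /and3P[/andP[]] := stab_okP (ltn_ord m).
have sz (m : 'I_24) : size (act (stab m) probe) = 36%N.
  by apply: size_act; have /and3P[] := stab_okP (ltn_ord m).
move=> /(congr1 (fun P => sgv 36 probe *m lift3 P)); rewrite !sgv_act //.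
move=> /(sgv_inj (sz k) (sz l)) eq_kl; apply: val_inj.
exact: (mkseq_uniqP _ _ stab_uniq _ _ (ltn_ord k) (ltn_ord l) eq_kl).
Qed.

(** Orbit and stabilizer: each automorphism is uniquely a stabilizer element followed by the chosen
    automorphism carrying [w0] to its signed image, so the order is 24 times 408 times 2. *)
Lemma card_code_aut : #|code_aut L17| = 19584%N.
Proof.
have exT (x : 'I_408 * bool) : exists T, T \in code_aut L17 /\
    wd 0 *m lift3 T = (-1) ^+ x.2 *: wd x.1.
  by have [T aT eqT] := UW_trans x.2 (ltn_ord x.1); exists T.
have [T TP] := fin_all_exists exT.
pose h (y : 'I_24 * ('I_408 * bool)) := (Q0 y.1)^T *m T y.2.
have aQ (k : 'I_24) := Q0_aut (ltn_ord k).
have Qt0 (k : 'I_24) : wd 0 *m lift3 (Q0 k)^T = wd 0.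
  by rewrite -{1}(Q0_wd0 (ltn_ord k)) -mulmxA lift3_tr lift3_mulT ?mulmx1 ?code_aut_monomial.
have h0 y : wd 0 *m lift3 (h y) = (-1) ^+ y.2.2 *: wd y.2.1.
  have [aT eqT] := TP y.2.
  by rewrite lift3_mul ?mulmxA ?Qt0 ?eqT ?monomial_tr ?code_aut_monomial.
have h_inj : injective h.
  move=> [k x] [l y] eq_h; have := h0 (k, x); rewrite eq_h h0 /= => eq_xy.
  have [eq1 eq2] := wd_inj (ltn_ord _) (ltn_ord _) eq_xy.
  have eqxy : x = y by case: x y {eq_h eq_xy} eq1 eq2 => [x b] [y c] /= /val_inj-> ->.
  rewrite eqxy in eq_h *; have [aT _] := TP y; congr (_, _); apply: Q0_inj.
  apply: (can_inj (@trmxK _ _ _)); move/(congr1 (fun X => X *m (T y)^T)): eq_h.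
  by rewrite /h /= -!mulmxA monomial_mulT ?mulmx1 ?code_aut_monomial.
have -> : code_aut L17 = h @: setT.
  apply/setP=> P; apply/idP/imsetP => [aP|[y _ ->]]; last first.
    by have [aT _] := TP y.2; rewrite code_aut_mul ?code_aut_tr.
  have [u lt_u [b eq_u]] := code_aut_UW aP (isT : (0 < 408)%N).
  pose x := (Ordinal lt_u, b); have [aT eqT] := TP x.
  have aPT := code_aut_mul aP (code_aut_tr aT).
  have [|k lt_k eq_k] := stab_wd0 aPT.
    rewrite lift3_mul ?code_aut_monomial ?code_aut_tr // mulmxA.
    have -> : wd 0 *m lift3 P = wd 0 *m lift3 (T x) by rewrite eqT eq_u.
    by rewrite -mulmxA lift3_tr lift3_mulT ?mulmx1 ?code_aut_monomial.
  exists (Ordinal lt_k, x) => //; rewrite /h /= -eq_k -mulmxA monomial_Tmul ?mulmx1 //.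
  exact: code_aut_monomial.
by rewrite card_imset // cardsT !card_prod !card_ord card_bool.
Qed.

Lemma card_hadamard_aut : #|hadamard_aut H17| = 19584%N.
Proof.
rewrite -card_code_aut -hadamard_aut_H17 card_in_imset //.
exact: hadamard_aut_inj hadamard_H17.
Qed.

(** * The Paley matrix and the design *)

(* Changing the sign of column 18 turns the block U into S. *)
Definition flip18 : seq nat := [seq if k == 18%N then (2 * k).+1 else (2 * k)%N | k <- iota 0 36].

Lemma flip18_ok : sperm 36 flip18. Proof. by vm_compute. Qed.

Lemma H17_paley_ok :
  all (fun s => let t := act flip18 s in (t \in paley_rows) || (map negb t \in paley_rows)) H17_rows.
Proof. by vm_compute. Qed.

Lemma hadamard_paley2_17 : hadamard paley2_17.
Proof. by rewrite paley2_17E; exact: had_okP PW_ok. Qed.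

Lemma size_HWi (i : 'I_36) : size (nth [::] H17_rows i) = 36%N.
Proof.
have ok : all (fun s => size s == 36%N) H17_rows by case/andP: HW_ok => /andP[].
by apply/eqP; apply: (nth_size ok); rewrite size_mkseq.
Qed.

Lemma H17_equiv_paley2_17 : hadamard_equiv H17 paley2_17.
Proof.
have mP := gmx_monomial flip18_ok.
have [|L LP] := maps_rows_isom hadamard_H17 mP (_ : maps_rows H17 _ paley2_17); last first.
  by exists (L, gmx 36 flip18).
move=> i; rewrite H17E paley2_17E row_bmx sgv_act ?flip18_ok //.
have lt_i : (i < size H17_rows)%N by rewrite size_mkseq.
have szP : size paley_rows = 36%N by rewrite size_mkseq.
have := nth_size H17_paley_ok lt_i.
move: (nth [::] H17_rows i) (size_HWi i) => s ss /orP[] /mem_row/(_ szP)[i' eq_i]; exists i'.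
  by exists false; rewrite scale1r row_bmx eq_i.
by exists true; rewrite row_bmx eq_i scaleN1r sgvN ?opprK // size_map.
Qed.

Lemma F17_sub_L17 : (mod3 F17 <= L17)%MS.
Proof.
by apply/row_subP=> i; rewrite -map_row -/(mod3 _); case/andP: (cword_F17 i).
Qed.

(** The right factor would be a code automorphism, which preserves the rows of H up to sign; then
    [w0], a row of H', would be one of them. *)
Lemma not_H17_equiv_F17 : ~ hadamard_equiv H17 F17.
Proof.
case=> [[L R] LR]; have aR := isom_code_aut F17_sub_L17 LR.
move: LR; rewrite inE /= => /and3P[/monomialP[s [b ->]] _ /eqP eqF].
have [i' [c eq_i]] := code_aut_H17 aR (s ord0).
have := row_F17_0; rewrite -eqF -mulmxA row_mul.
have -> : row ord0 (lift3 (mono s b)) = (-1) ^+ b ord0 *: delta_mx 0 (s ord0) :> 'rV[int]_36.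
  apply/rowP=> j; rewrite lift3_mono !mxE eqxx /=.
  by case: (j == s ord0); rewrite ?mulr1 ?mulr0.
rewrite -scalemxAl -rowE row_mul eq_i scalerA -signr_addb => eq_0.
have := ip_w0_HW i'; rewrite -eq_0 ipZl hadamard_ip ?hadamard_H17 // eqxx.
by case: (_ (+) _).
Qed.

(** * Regularity of H' and its design *)

Lemma card_sgv n s : size s = n -> #|[set j | sgv n s 0 j == -1]| = count id s.
Proof.
move=> ss; rewrite -sum1_count (big_nth false) ss big_mkord sum1_card.
by apply: eq_card => j; rewrite inE mxE -topredE /=; case: nth.
Qed.

Lemma regular_F17 : regular F17.
Proof.
have cF (i : 'I_36) : #|[set j | F17 i j == -1]| = 21%N.
  have -> : [set j | F17 i j == -1] = [set j | sgv 36 (nth [::] F17_rows i) 0 j == -1].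
    by apply/setP=> j; rewrite !inE mxE.
  have lt_i : (i < size F17_rows)%N by rewrite size_FW.
  by rewrite card_sgv ?size_FWi //; apply/eqP; exact: (nth_size FW_count lt_i).
by apply/forallP=> i; apply/forallP=> i'; rewrite !cF.
Qed.

Lemma incE n T (i j : 'I_n) :
  hadamard_incidence (bmx n T) i j = (~~ nth false (nth [::] T i) j)%:R.
Proof. by rewrite !mxE; case: nth. Qed.

Lemma FW_blocks : all (fun s => count negb s == 15%N) F17_rows. Proof. by vm_compute. Qed.

Lemma FW_points : all (fun j => all (fun k => (j == k) ||
  (count (fun s => ~~ nth false s j && ~~ nth false s k) F17_rows == 6%N)) (iota 0 36)) (iota 0 36).
Proof. by vm_compute. Qed.

Lemma sum_count (T : Type) (x0 : T) (p : pred T) n s : size s = n ->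
  \sum_(i < n) (p (nth x0 s i))%:R = (count p s)%:R :> int.
Proof.
move=> ss; rewrite -sum1_count (big_nth x0) ss big_mkord natr_sum [RHS]big_mkcond.
by apply: eq_bigr => i _; case: (p _).
Qed.

Lemma design_F17 : symmetric_2design 15 6 (hadamard_incidence F17).
Proof.
apply/and3P; split.
- by apply/forallP=> i; apply/forallP=> j; rewrite incE; case: nth.
- apply/forallP=> i; under eq_bigr do rewrite incE.
  have lt_i : (i < size F17_rows)%N by rewrite size_FW.
  rewrite (sum_count false negb (size_FWi (ltn_ord i))).
  by rewrite (eqP (nth_size FW_blocks lt_i)).
apply/forallP=> j; apply/forallP=> k; apply/implyP=> ne_jk.
under eq_bigr do rewrite !incE -natrM mulnb.
rewrite (sum_count [::] (fun s => ~~ nth false s j && ~~ nth false s k) size_FW).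
have /orP[/eqP/val_inj eq_jk|/eqP->//] := forall_ord2P FW_points j k.
by rewrite eq_jk eqxx in ne_jk.
Qed.

(** A point permutation preserving the blocks is a monomial matrix without signs; it fixes the
    all-one word, so [rigid_ones] applies. *)
Lemma design_aut_F17 : design_aut (hadamard_incidence F17) = [set 1%g].
Proof.
apply/setP=> s; rewrite !inE; apply/existsP/eqP => [[t /eqP eqA]|->]; last first.
  by exists 1%g; rewrite row_perm1 col_perm1.
have eqF i j : F17 (t i) (s j) = F17 i j.
  move/matrixP/(_ i j): eqA; rewrite 2!mxE !incE 4!mxE.
  by case: (nth _ _ _); case: (nth _ _ _).
pose P : 'M['F_3]_36 := mono s [ffun=> false].
have mP : monomial_mx P by apply/monomialP; exists s, [ffun=> false].
have P1 : P = 1%:M.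
  apply: rigid_ones => // [i|]; last first.
    apply/rowP=> j; rewrite lift3_mono mulmx_mono ffunE mulr1 !mxE.
    by rewrite !nth_nseq !ltn_ord.
  exists (t i), false; rewrite scale1r; apply/rowP=> j.
  rewrite lift3_mono mulmx_mono ffunE mulr1 ![row _ _ _ _]mxE.
  by rewrite -eqF permKV.
apply/permP=> i; rewrite perm1; apply/eqP; rewrite eq_sym.
by move/matrixP/(_ i (s i)): P1; rewrite !mxE eqxx ffunE; case: eqP.
Qed.

(** * Extremality *)

(** The rows of H span the code, and H H^T = 36 I vanishes modulo 3. *)
Lemma L17_self_orth : L17 *m L17^T = 0.
Proof.
have /submxP[D ->] : (L17 <= mod3 H17)%MS by case/andP: mod3_H17.
rewrite trmx_mul mulmxA -(mulmxA D) /mod3 map_trmx -map_mxM.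
case/andP: hadamard_H17 => _ /eqP->; rewrite map_scalar_mx /=.
have -> : (36%:R : int)%:~R = 0 :> 'F_3 by apply/val_inj.
by rewrite raddf0 mulmx0 mul0mx.
Qed.

Lemma rank_L17 : \rank L17 = 18%N.
Proof.
apply/eqP; rewrite eqn_leq rank_leq_row /=.
have L1 : row_mx 1%:M (mod3 (U_mx label17)) *m col_mx 1%:M 0 = 1%:M :> 'M_18.
  by rewrite mul_row_col mulmx1 mulmx0 addr0.
by rewrite -{1}(mxrank1 'F_3 18) -L1 mxrankM_maxl.
Qed.

Lemma self_dual_L17 m (C : 'M['F_3]_(m, 36)) : (C == L17)%MS -> self_dual C.
Proof.
move=> eqC; have rC : \rank C = 18%N by rewrite (eqmxP eqC) rank_L17.
have sC : (C <= kermx C^T)%MS.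
  have /submxP[D ->] : (C <= L17)%MS by case/andP: eqC.
  by apply/sub_kermxP; rewrite trmx_mul mulmxA -(mulmxA D) L17_self_orth mulmx0 mul0mx.
rewrite /self_dual -(geq_leqif (mxrank_leqif_eq sC)) mxrank_ker mxrank_tr rC.
done.
Qed.

Fixpoint wtl (l : seq trit) : nat :=
  match l with
  | [::] => 0
  | None :: l' => wtl l'
  | Some _ :: l' => (wtl l').+1
  end%N.

Lemma wtlE l : wtl l = count (fun t => t != None) l.
Proof. by elim: l => [|[b|] l /= ->]. Qed.

Lemma wt_trow n l : size l = n -> wt (trow n l) = wtl l.
Proof.
move=> sl; rewrite /wt wtlE -sum1_count (big_nth None) sl big_mkord sum1_card.
apply: eq_card => j; rewrite inE mxE -topredE /=.
by case: (nth _ _ _) => [b|]; rewrite /= ?signr_eq0 ?eqxx.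
Qed.

Lemma wt_row_mx m n (u : 'rV['F_3]_m) (v : 'rV_n) : wt (row_mx u v) = (wt u + wt v)%N.
Proof.
rewrite /wt -!sum1_card big_split_ord /=.
by congr (_ + _)%N; apply: eq_bigl => j; rewrite !inE ?row_mxEl ?row_mxEr.
Qed.

(** Nonzero elements of GF(3) have square 1, so the inner product of a word with itself is its
    weight modulo 3. *)
Lemma wt_dvd3 n (v : 'rV['F_3]_n) : v *m v^T = 0 -> (3 %| wt v)%N.
Proof.
move/matrixP/(_ 0 0); rewrite !mxE; under eq_bigr do rewrite mxE.
have -> : \sum_j v 0 j * v 0 j = (wt v)%:R.
  rewrite /wt -sum1_card natr_sum [RHS]big_mkcond; apply: eq_bigr => j _; rewrite inE.
  by case/or3P: (F3_cases (v 0 j)) => /eqP->; apply/val_inj.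
by move/eqP; rewrite -(dvdn_pcharf (pchar_Fp (isT : prime 3))).
Qed.

(* Every combination of at least one and at most k further rows, added to [acc]
   which already uses w rows, has total weight at least 10. *)
Fixpoint heavy (R : seq (seq trit)) (k w : nat) (acc : seq trit) : bool :=
  if R is r :: R' then
    heavy R' k w acc &&
    (if k is k'.+1 then
       heavy R' k' w.+1 (taddl acc r) &&
       heavy R' k' w.+1 (taddl acc (map (tmul (Some true)) r))
     else true)
  else (w == 0%N) || (9 < w + wtl acc)%N.

Lemma tadd0 n l : size l = n -> taddl l (nseq n None) = l.
Proof. by move<-; elim: l => //= [[[]|] l] ->. Qed.

Lemma heavyP n R k w acc x : heavy R k w acc -> size acc = n ->
    all (fun r => size r == n) R -> size x = size R -> (wtl x <= k)%N ->
  (w + wtl x == 0)%N || (9 < w + wtl x + wtl (comb x R acc))%N.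
Proof.
elim: R k w acc x => [|r R IHR] k w acc [|a x] //=; first by rewrite addn0.
case/andP=> hv0 hv1 sacc /andP[/eqP sr sR] [sx].
case: a => [b|] /=; last first.
  move=> le_k; have -> : map (tmul None) r = nseq n None.
    by rewrite -sr; elim: r {sr hv1} => //= t r ->.
  by rewrite tadd0 //; apply: (IHR k).
case: k hv0 hv1 => // k _ /andP[hv1 hv2] le_k; rewrite addnS -addSn.
have {hv1 hv2} : heavy R k w.+1 (taddl acc (map (tmul (Some b)) r)).
  case: b => //; rewrite (_ : map _ r = r) //.
  by rewrite -[RHS]map_id; apply: eq_map => -[].
by move/IHR; apply; rewrite ?size_taddl ?size_map ?sr.
Qed.

Definition negUT_rows : seq (seq trit) := mk_table (fun i j => tmul (Some true) (U_trit j i)) 18 18.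

Lemma heavy_UT : heavy U_rows 4 0 (nseq 18 None). Proof. by vm_compute. Qed.
Lemma heavy_NT : heavy negUT_rows 4 0 (nseq 18 None). Proof. by vm_compute. Qed.

Lemma size_NT : all (fun r => size r == 18%N) negUT_rows. Proof. by vm_compute. Qed.

Lemma matrix_NT : \matrix_i trow 18 (nth [::] negUT_rows i) = - (mod3 (U_mx label17))^T.
Proof.
apply/matrixP=> i j; rewrite 2!mxE nth_table tF_mul mulN1r 2![in RHS]mxE [in RHS]mxE.
by rewrite U_mx17 intr_tZ.
Qed.

(** Self-orthogonality reads I + U U^T = 0, so the right half is an information set as well. *)
Lemma L17_right (x y : 'rV['F_3]_18) : (row_mx x y <= L17)%MS -> x = y *m - (mod3 (U_mx label17))^T.
Proof.
case/submxP=> D; rewrite /L17 /L_code mul_mx_row mulmx1 => /eq_row_mx[-> ->].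
have E : row_mx 1%:M (mod3 (U_mx label17)) *m (row_mx 1%:M (mod3 (U_mx label17)))^T = 0.
  exact: L17_self_orth.
move: E; rewrite tr_row_mx mul_row_col trmx1 mulmx1 => /eqP; rewrite addr_eq0 => /eqP UU.
by rewrite mulmxN -mulmxA -[mod3 _ *m _]opprK -UU mulmxN mulmx1 opprK.
Qed.

(** Weights are multiples of 3, so it suffices to exceed 9. Otherwise one half has weight at most 4,
    and the word is a combination of at most 4 rows of (I, U) or of (-U^T, I); [heavy] has examined
    all of these. *)
Lemma L17_min_weight (v : 'rV['F_3]_36) : (v <= L17)%MS -> v != 0 -> (12 <= wt v)%N.
Proof.
move=> vL v0; have d3 : (3 %| wt v)%N.
  apply: wt_dvd3; have /submxP[D ->] := vL.
  by rewrite trmx_mul mulmxA -(mulmxA D) L17_self_orth mulmx0 mul0mx.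
suff : (9 < wt v)%N by case/dvdnP: d3 => q ->; lia.
move: vL v0; rewrite -[v](@hsubmxK _ 1 18 18).
have [k sk ->] := trow_surj (@lsubmx _ 1 18 18 v).
have [l sl ->] := trow_surj (@rsubmx _ 1 18 18 v).
move=> vL v0; rewrite [wt _](@wt_row_mx 18 18) !wt_trow //.
have eq_k := L17_right vL; rewrite -matrix_NT in eq_k.
move: (vL); rewrite L17_trow // => /eqP eq_l.
have c0 R (m : seq trit) : size R = 18%N -> all (fun r => size r == 18%N) R -> size m = 18%N ->
    trow 18 (comb m R (nseq 18 None)) = trow 18 m *m \matrix_i trow 18 (nth [::] R i).
  move=> sR sRn sm; rewrite (@trow_comb 18) ?size_nseq //.
  by rewrite (_ : trow 18 (nseq 18 None) = 0) ?add0r //; apply/rowP=> j; rewrite !mxE nth_nseq ltn_ord.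
have eq_k' : k = comb l negUT_rows (nseq 18 None).
  apply: (@trow_inj 18) => //; first by rewrite (@size_comb 18) ?size_nseq ?size_NT.
  by rewrite c0 ?size_NT ?size_mkseq.
have nz (m : seq trit) : size m = 18%N -> wtl m = 0%N -> trow 18 m = 0.
  move=> sm /eqP; rewrite wtlE eqn0Ngt -has_count => /hasPn m0; apply/rowP=> j; rewrite !mxE.
  by have := m0 _ (mem_nth None (_ : (j < size m)%N)); rewrite sm negbK => /(_ (ltn_ord j))/eqP->.
have [le_k|gt_k] := leqP (wtl k) 4.
  have sU : size k = size U_rows by rewrite sk size_mkseq.
  have := heavyP heavy_UT (size_nseq _ _) size_UT sU le_k; rewrite -eq_l.
  case/orP=> // /eqP wk; case/negP: v0; have tk := nz k sk wk.
  have -> : trow 18 l = 0 by rewrite eq_l c0 ?size_UT ?size_mkseq // tk mul0mx.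
  by rewrite tk row_mx0.
have [le_l|gt_l] := leqP (wtl l) 4; last by lia.
have sN : size l = size negUT_rows by rewrite sl size_mkseq.
have := heavyP heavy_NT (size_nseq _ _) size_NT sN le_l; rewrite -eq_k'.
case/orP=> [/eqP wl|]; last by rewrite add0n addnC.
case/negP: v0; have tl := nz l sl wl.
have -> : trow 18 k = 0 by rewrite eq_k tl mul0mx.
by rewrite tl row_mx0.
Qed.

Definition weight12_coef : seq trit := [:: Some false, Some false & nseq 16 None].

Lemma weight12_coef_wt : (wtl weight12_coef + wtl (comb weight12_coef U_rows (nseq 18 None)) == 12)%N.
Proof. by vm_compute. Qed.

Lemma min_distance_L17 m (C : 'M['F_3]_(m, 36)) : (C == L17)%MS -> min_distance C 12.
Proof.
move=> /eqmxP eqC; split=> [|v]; last by rewrite eqC; apply: L17_min_weight.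
have sc : size (comb weight12_coef U_rows (nseq 18 None)) = 18%N.
  by rewrite (@size_comb 18) ?size_nseq ?size_UT.
exists (row_mx (trow 18 weight12_coef) (trow 18 (comb weight12_coef U_rows (nseq 18 None)))).
have w12 : wt (row_mx (trow 18 weight12_coef) (trow 18 (comb weight12_coef U_rows (nseq 18 None)))) = 12%N.
  by rewrite [wt _](@wt_row_mx 18 18) !wt_trow //; apply/eqP; exact: weight12_coef_wt.
split=> //; first by rewrite eqC L17_trow.
apply/eqP=> v0; move: w12; rewrite v0 /wt.
by rewrite (_ : [set j | _] = set0) ?cards0 //; apply/setP=> j; rewrite !inE mxE eqxx.
Qed.

(* Row i of L17 as a combination of the blocks of the design, the digit 2
   standing for -1. *)
Definition span_coef : seq (seq N) :=
  [:: [:: 0; 2; 1; 1; 1; 2; 1; 1; 0; 2; 1; 2; 2; 2; 1; 0; 0; 1; 2];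
     [:: 1; 1; 2; 0; 1; 2; 2; 2; 2; 0; 2; 2; 0; 1; 0; 1; 0; 1; 0];
     [:: 1; 0; 2; 2; 1; 0; 1; 1; 2; 1; 2; 2; 1; 0; 1; 2; 0; 0; 0];
     [:: 0; 2; 0; 1; 2; 2; 0; 1; 1; 0; 1; 2; 0; 0; 0; 0; 0; 2; 1];
     [:: 0; 2; 0; 0; 2; 2; 2; 0; 1; 0; 0; 2; 2; 2; 2; 2; 0; 0; 0];
     [:: 0; 0; 1; 0; 1; 1; 2; 0; 0; 0; 0; 2; 2; 2; 2; 2; 0; 1; 0];
     [:: 2; 2; 0; 2; 2; 0; 0; 0; 2; 2; 0; 0; 0; 1; 2; 2; 0; 1; 2];
     [:: 0; 1; 1; 1; 0; 0; 0; 2; 0; 1; 2; 2; 0; 2; 0; 1; 0; 2; 1];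
     [:: 2; 2; 1; 0; 2; 2; 1; 0; 1; 1; 0; 0; 2; 2; 0; 0; 0; 1; 1];
     [:: 2; 0; 0; 1; 0; 1; 0; 1; 1; 0; 1; 2; 0; 1; 1; 2; 0; 0; 1];
     [:: 2; 1; 0; 2; 0; 1; 0; 1; 1; 0; 0; 1; 0; 2; 1; 2; 0; 0; 2];
     [:: 2; 2; 0; 1; 0; 2; 0; 1; 0; 2; 1; 1; 1; 1; 2; 1; 0; 1; 0];
     [:: 0; 2; 1; 2; 2; 1; 2; 2; 0; 1; 2; 1; 1; 1; 1; 1; 0; 1; 0];
     [:: 1; 2; 1; 1; 2; 2; 0; 1; 0; 2; 2; 1; 2; 2; 1; 0; 0; 0; 2];
     [:: 2; 1; 0; 2; 0; 1; 0; 2; 1; 0; 1; 1; 2; 2; 1; 1; 0; 2; 0];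
     [:: 1; 1; 2; 1; 0; 2; 0; 0; 1; 0; 1; 0; 0; 0; 1; 1; 0; 2; 2];
     [:: 0; 1; 2; 0; 2; 2; 1; 0; 1; 2; 2; 0; 1; 2; 2; 0; 0; 1; 2];
     [:: 1; 0; 1; 0; 2; 1; 2; 0; 2; 2; 0; 2; 0; 1; 1; 2; 0; 0; 2]]%num.
Definition digit (c : N) : trit :=
  match nat_of_bin c with 0 => None | 1 => Some false | _ => Some true end%N.

Definition block_rows : seq (seq trit) := [seq [seq if b then None else Some false | b <- s] | s <- F17_rows].

Definition L17_rows : seq (seq trit) :=
  mk_table (fun i j => if (j < 18)%N then (if i == j then Some false else None)
                       else U_trit i (j - 18)) 18 36.

(** The lists in [span_coef] omit trailing zeros. *)
Definition coef (i : nat) : seq trit :=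
  let c := map digit (nth [::] span_coef i) in c ++ nseq (36 - size c) None.

Lemma span_ok : all (fun i => (size (coef i) == 36%N) &&
  (comb (coef i) block_rows (nseq 36 None) == nth [::] L17_rows i)) (iota 0 18).
Proof. by vm_compute. Qed.

Lemma size_AT : all (fun r => size r == 36%N) block_rows. Proof. by vm_compute. Qed.

Lemma size_ATn : size block_rows = 36%N. Proof. by vm_compute. Qed.

Lemma mod3_incidence : mod3 (hadamard_incidence F17) = \matrix_i trow 36 (nth [::] block_rows i).
Proof.
apply/matrixP=> i j; rewrite [LHS]mxE incE 2!mxE (nth_map [::]) ?size_FW //.
by rewrite (nth_map false) ?size_FWi //; case: nth.
Qed.

Lemma row_L17 (i : 'I_18) : row i L17 = trow 36 (nth [::] L17_rows i).
Proof.
apply/rowP=> j; rewrite [LHS]mxE [RHS]mxE nth_table /L17 /L_code mxE.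
case: splitP => j' ->; first by rewrite ltn_ord mxE -val_eqE /=; case: (_ == _ :> nat).
by rewrite ltnNge leq_addr addKn mxE U_mx17 intr_tZ.
Qed.

Lemma incidence_L17 : (mod3 (hadamard_incidence F17) == L17)%MS.
Proof.
apply/andP; split; last first.
  apply/row_subP=> i; have /andP[/eqP sc /eqP ci] := forall_ordP span_ok i.
  rewrite row_L17 -ci (@trow_comb 36) ?size_nseq ?size_AT // ?size_ATn //.
  rewrite (_ : trow 36 (nseq 36 None) = 0) ?add0r; last first.
    by apply/rowP=> j; rewrite !mxE nth_nseq ltn_ord.
  by rewrite -mod3_incidence submxMl.
apply/row_subP=> i.
(* Halving is negation modulo 3, so (x + 1)/2 is -(x + 1), and the all-one word is a row of H. *)
have -> : row i (mod3 (hadamard_incidence F17)) = - (mod3 (row i F17) + mod3 (row ord0 H17)).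
  apply/rowP=> j; rewrite row_H17_0 row_bmx [LHS]mxE [LHS]mxE incE !mxE nth_nseq ltn_ord.
  by case: nth; apply/val_inj.
rewrite -scaleN1r scalemx_sub // addmx_sub //.
  by case/andP: (cword_F17 i).
by case/andP: (cword_H17 ord0).
Qed.

(** * Equivalence with the Pless symmetry code *)

Lemma mulmx_gmx n m (A : 'M['F_3]_(m, n)) g i (j k : 'I_n) :
  j = (nth 0%N g k)./2 :> nat -> (A *m gmx n g) i k = A i j * (-1) ^+ odd (nth 0%N g k).
Proof.
move=> eq_j; rewrite mxE (bigD1 j) //= big1 ?addr0 => [|l ne].
  by rewrite mxE eq_j eqxx.
by rewrite mxE ifN ?mulr0 //; apply: contra ne; rewrite -eq_j.
Qed.

Lemma flip_ut : all (fun i => all (fun j =>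
  tmul (U_trit i j) (Some (j == 0%N)) == S_trit i j) (iota 0 18)) (iota 0 18).
Proof. by vm_compute. Qed.

(** As -1 is a square modulo 17, the nonzero entries of column infinity are 1 in S and -1 in U, and
    all other columns agree. *)
Lemma L17_flip : L17 *m gmx 36 flip18 = C17.
Proof.
apply/matrixP=> i k; have nk : nth 0%N flip18 k = if k == 18%N :> nat then (2 * k).+1 else (2 * k)%N.
  by rewrite (nth_map 0%N) ?size_iota // nth_iota.
have [k2 ok] : (nth 0%N flip18 k)./2 = k /\ odd (nth 0%N flip18 k) = (k == 18%N :> nat).
  by rewrite nk; case: eqP => _; rewrite mul2n /= ?uphalf_double ?doubleK ?odd_double.
rewrite (mulmx_gmx _ _ (esym k2)) ok /L17 /C17 /L_code /pless_code 2!mxE.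
case: splitP => j ej; rewrite ej; first by rewrite !mxE (ltn_eqF (ltn_ord j)) mulr1.
have -> : (18 + j == 18)%N = (j == 0%N :> nat) by rewrite -[X in _ == X]addn0 eqn_add2l.
rewrite [X in X * _]mxE [RHS]mxE U_mx17 S_mx17 !intr_tZ.
by rewrite -(eqP (forall_ord2P flip_ut i j)) tF_mul.
Qed.

Lemma incidence_C17 : code_equiv (mod3 (hadamard_incidence F17)) C17.
Proof.
exists (gmx 36 flip18); split; first exact: gmx_monomial flip18_ok.
by apply/eqmxP; rewrite -L17_flip; apply: eqmxMr; apply/eqmxP/incidence_L17.
Qed.

Lemma incidence_extremal : extremal36 (mod3 (hadamard_incidence F17)).
Proof.
have eqL := incidence_L17; split; first exact: self_dual_L17.
  by rewrite (eqmxP eqL) rank_L17.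
exact: min_distance_L17.
Qed.

Theorem theorem3 :
  (exists H' : 'M[int]_36,
    [/\ hadamard_in_code L17 H17,
        hadamard_in_code L17 H',
        ~ hadamard_equiv H17 H'
      & forall M : 'M[int]_36, hadamard_in_code L17 M ->
          hadamard_equiv M H17 \/ hadamard_equiv M H']
    /\ [/\ hadamard paley2_17,
           hadamard_equiv H17 paley2_17
         & #|hadamard_aut H17| = 19584%N]
    /\ [/\ regular H',
           symmetric_2design 15 6 (hadamard_incidence H')
         & design_aut (hadamard_incidence H') = [set 1%g]]
    /\ [/\ extremal36 (mod3 (hadamard_incidence H'))
         & code_equiv (mod3 (hadamard_incidence H')) C17])
  /\ [/\ {in hadamard_aut H17 &, injective (fun LR => LR.2)}
       & [set LR.2 | LR in hadamard_aut H17] = code_aut L17].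
Proof.
split; last first.
  by split; [exact: hadamard_aut_inj hadamard_H17|exact: hadamard_aut_H17].
exists F17; split; last split; last split.
- split; [exact: H17_in_code|exact: F17_in_code|exact: not_H17_equiv_F17|].
  exact: hadamard_code_classification.
- split; [exact: hadamard_paley2_17|exact: H17_equiv_paley2_17|].
  exact: card_hadamard_aut.
- by split; [exact: regular_F17|exact: design_F17|exact: design_aut_F17].
- by split; [exact: incidence_extremal|exact: incidence_C17].
Qed.
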